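(* Let $d\ge2$ and let $X\subseteq\mathbb{N}^d$ be a monotone set, i.e. $(\mathbb{N}^d\setminus X)+e_j\subseteq\mathbb{N}^d\setminus X$ for all $j=1,\dots,d$. Let $H_d(\mathbb{N}^d\setminus X)$ be the subspace of the Drury-Arveson space $H_d$ consisting of the functions whose Taylor coefficients vanish on $X$. (a) If $X$ is bounded, then there are finitely many $m_1,\dots,m_K\in\mathbb{N}^d$ (none if $X=\emptyset$) such that $X=\bigcup_{k=1}^K R_{m_k}$, where $R_m=\{n\in\mathbb{N}^d : n_j\le m_j\ \text{for all } j\}$, and $$H_d(\mathbb{N}^d\setminus X)=\bigcap_{k=1}^{K}\ker H_{z^{m_k}}.$$ (b) If $X$ is unbounded, then there is a sequence $(m_k)_{k\ge1}$ in $\mathbb{N}^d$ such that $$H_d(\mathbb{N}^d\setminus X)=\bigcap_{k=1}^{\infty}\ker H_{z^{m_k}}.$$ Here $H_{z^m}$ denotes the Hankel operator on $H_d$ with symbol $b(z)=z^m$.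
   Context: $\mathbb{N}=\{0,1,2,\dots\}$; $e_1,\dots,e_d$ is the standard basis of $\mathbb{N}^d$. For $n\in\mathbb{N}^d$ put $|n|=n_1+\dots+n_d$, $n!=n_1!\cdots n_d!$, $\beta(n)=|n|!/n!$. The Drury-Arveson space $H_d$ is the Hilbert space of holomorphic functions $f(z)=\sum_{n\in\mathbb{N}^d}a(n)z^n$ on the unit ball $\mathbb{B}^d\subset\mathbb{C}^d$ with $\Vert f\Vert_{H_d}^2=\sum_n|a(n)|^2\beta(n)^{-1}<\infty$. $\mathrm{Hol}(\overline{\mathbb{B}^d})$ denotes the functions holomorphic on (a neighbourhood of) the closed ball $\overline{\mathbb{B}^d}$; they are dense in $H_d$. A function $b\in H_d$ is a (Hankel) symbol if there is $C>0$ with $|\langle fg,b\rangle_{H_d}|\le C\Vert f\Vert_{H_d}\Vert g\Vert_{H_d}$ for all $f,g\in\mathrm{Hol}(\overline{\mathbb{B}^d})$. Let $\overline{H_d}=\{\bar f: f\in H_d\}$ with inner product $\langle\bar f,\bar g\rangle_{\overline{H_d}}=\langle g,f\rangle_{H_d}$. For a symbol $b$, the Hankel operator $H_b:H_d\to\overline{H_d}$ is the bounded linear operator determined by $\langle H_bf,\bar g\rangle_{\overline{H_d}}=\langle fg,b\rangle_{H_d}$ for $f,g\in\mathrm{Hol}(\overline{\mathbb{B}^d})$. Monomials $z^m$ are symbols. An empty intersection of subspaces of $H_d$ is understood to be $H_d$. *)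

(* Defs.v *)
From HB Require Import structures.
From mathcomp Require Import all_boot all_order all_algebra finmap complex.
From mathcomp Require Import all_classical all_reals all_analysis.
From mathcomp Require summability.
Import numFieldNormedType.Exports.
Import Order.TTheory GRing.Theory Num.Theory.

Set Implicit Arguments.
Unset Strict Implicit.
Unset Printing Implicit Defensive.

Local Open Scope ring_scope.
Local Open Scope classical_set_scope.

(* R[i] packaged as a numClosedFieldType, so that the topology and norm which
   MathComp-Analysis puts on every numFieldType apply to it. *)
Definition Cplx (R : realType) : numClosedFieldType := R[i].

(* Elements of N^d; addition is the pointwise addition of {ffun _ -> nat}. *)
Definition mindex (d : nat) := {ffun 'I_d -> nat}.

Section MultiIndex.
Context {d : nat}.
Implicit Types (n m : mindex d) (X : set (mindex d)).

Definition unit_index (j : 'I_d) : mindex d := [ffun i => (i == j : nat)].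

Definition mdegree n : nat := \sum_(j < d) n j.

Definition mfactorial n : nat := \prod_(j < d) (n j)`!.

Definition monotone_index_set X : Prop :=
  forall n (j : 'I_d), (~` X) n -> (~` X) ((n + unit_index j)%R : mindex d).

Definition bounded_index_set X : Prop :=
  exists N : nat, forall n, X n -> (mdegree n <= N)%N.

Definition box m : set (mindex d) :=
  [set n | forall j : 'I_d, (n j <= m j)%N].

End MultiIndex.

Section DruryArveson.
Context {R : realType} {d : nat}.
Local Notation C := (Cplx R).

Definition mbeta (n : mindex d) : C := (mdegree n)`!%:R / (mfactorial n)%:R.

Definition mpower (z : 'rV[C]_d) (n : mindex d) : C :=
  \prod_(j < d) z ord0 j ^+ n j.

(* [|.|] on 'rV_d is the sup norm in the library, so the Euclidean norm is
   written out. *)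
Definition sqnorm (z : 'rV[C]_d) : C := \sum_(j < d) `|z ord0 j| ^+ 2.

Definition closed_ball_d : set 'rV[C]_d := [set z | sqnorm z <= 1].

Definition Bd := {z : 'rV[C]_d | sqnorm z < 1}.

(* Families indexed by N^d are summed unconditionally, i.e. along the filter
   [totally] of finite sets of indices. *)
Definition has_isum (x : mindex d -> C) (s : C) : Prop :=
  summability.partial_sum x @ summability.totally --> s.

Definition isummable (x : mindex d -> C) : Prop := exists s, has_isum x s.

Definition isum (x : mindex d -> C) : C := summability.sum x.

Definition has_power_series (f : Bd -> C) (a : mindex d -> C) : Prop :=
  forall z : Bd, has_isum (fun n => a n * mpower (val z) n) (f z).

(* The (unique) coefficients of the power series of f; 0 if there is none. *)
Definition taylor (f : Bd -> C) : mindex d -> C :=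
  xget (fun=> 0) [set a | has_power_series f a].

(* The Drury-Arveson space H_d, as a set of functions on the ball. *)
Definition DA : set (Bd -> C) :=
  [set f | exists2 a, has_power_series f a &
                      isummable (fun n => `|a n| ^+ 2 / mbeta n)].

Definition DA_inner (f g : Bd -> C) : C :=
  isum (fun n => taylor f n * (taylor g n)^* / mbeta n).

Definition DA_norm (f : Bd -> C) : C :=
  sqrtC (isum (fun n => `|taylor f n| ^+ 2 / mbeta n)).

(* The functions in H_d whose Taylor coefficients vanish outside Y. *)
Definition DA_on (Y : set (mindex d)) : set (Bd -> C) :=
  [set f | DA f /\ forall n, (~` Y) n -> taylor f n = 0].

Definition conjf (f : Bd -> C) : Bd -> C := fun z => (f z)^*.

Definition DAbar : set (Bd -> C) := conjf @` DA.

(* For F = conjf f and G = conjf g this is <g, f>. *)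
Definition DAbar_inner (F G : Bd -> C) : C := DA_inner (conjf G) (conjf F).

Definition DAbar_norm (F : Bd -> C) : C := DA_norm (conjf F).

(* Holomorphic in several variables: locally the sum of a power series. *)
Definition holomorphic_on (U : set 'rV[C]_d) (F : 'rV[C]_d -> C) : Prop :=
  forall p, U p -> exists c : mindex d -> C,
    \forall z \near p, has_isum (fun n => c n * mpower (z - p) n) (F z).

(* Hol of the closed ball, its elements being restricted to the open ball. *)
Definition Hol_closed_ball : set (Bd -> C) :=
  [set f | exists (U : set 'rV[C]_d) (F : 'rV[C]_d -> C),
     [/\ open U, closed_ball_d `<=` U, holomorphic_on U F
       & forall z : Bd, f z = F (val z)]].

Definition is_symbol (b : Bd -> C) : Prop :=
  DA b /\ exists2 M : C, 0 < M & forall f g : Bd -> C,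
    Hol_closed_ball f -> Hol_closed_ball g ->
    `|DA_inner (fun z => f z * g z) b| <= M * DA_norm f * DA_norm g.

(* T restricts to a bounded linear operator from H_d to its conjugate space
   which satisfies the identity that determines the Hankel operator of b.  Only
   the values of T on H_d are meaningful. *)
Definition is_hankel (b : Bd -> C) (T : (Bd -> C) -> (Bd -> C)) : Prop :=
  [/\ is_symbol b,
      forall f, DA f -> DAbar (T f),
      forall (c : C) f g, DA f -> DA g ->
        T (fun z => c * f z + g z) = (fun z => c * T f z + T g z),
      exists M : C, forall f, DA f -> DAbar_norm (T f) <= M * DA_norm f
    & forall f g, Hol_closed_ball f -> Hol_closed_ball g ->
        DAbar_inner (T f) (conjf g) = DA_inner (fun z => f z * g z) b].

Definition hankel (b : Bd -> C) : (Bd -> C) -> (Bd -> C) :=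
  xget (fun _ _ => 0) [set T | is_hankel b T].

Definition hankel_ker (b : Bd -> C) : set (Bd -> C) :=
  [set f | DA f /\ hankel b f = fun=> 0].

Definition zmonomial (m : mindex d) : Bd -> C := fun z => mpower (val z) m.

End DruryArveson.
Arguments Bd : clear implicits.
Arguments DA : clear implicits.
Arguments DA_on R {d} Y.
Arguments zmonomial R {d} m.

(* Main.v *)
(* On H_d the Hankel operator of z^m sends f to the conjugate of the polynomial
   with coefficients conj (f^(m - k)) beta(k) / beta(m), k <= m, so its kernel
   is { f | f^(n) = 0 for all n <= m }; both claims follow because a monotone
   set is closed under taking smaller indices, hence is the union of the boxes
   R_m, m in X.  The substance is that a function analytic near the closed ball,
   locally the sum of power series, lies in H_d.  This is proved without
   integrals: Cauchy's inequality comes from averaging over vectors of roots of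
   unity, and comparing re-expansions at nearby points (with a uniform radius,
   by compactness) enlarges the domain of convergence of the series at 0 step by
   step until it contains a larger ball. *)
From mathcomp Require Import all_boot all_order all_algebra finmap complex.
From mathcomp Require Import all_classical all_reals all_analysis.
From mathcomp Require summability.
From mathcomp Require Import cyclic separable cyclotomic ring lra zify.
Require Import Defs.
Import numFieldNormedType.Exports.
Import Order.TTheory GRing.Theory Num.Theory.

Set Implicit Arguments.
Unset Strict Implicit.
Unset Printing Implicit Defensive.

Local Open Scope ring_scope.
Local Open Scope classical_set_scope.

(* The definitions of symbol and Hankel operator quantify over all functions analytic on the closed
   ball, while [DA_norm] and [DA_inner] are read off from [taylor], which is 0 for a function
   without a power series on the ball; nothing can be estimated before such functions are known to
   lie in [H_d]. The obstacle is the shape of the ball: a Cauchy estimate on one polydisc inside it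
   lets a(n) grow too fast. So the estimate is kept for all polyradii rho with |rho| <= t at once
   ([coef_bound]), and rho is chosen only at the end, separately for each n. A radius t > 1 is
   essential: at t = 1 the resulting bound on |a(n)|^2 / beta(n) is merely polynomial, and the
   surplus t^(-2|n|) makes it summable. Since [hankel] selects some operator meeting the
   specification, two facts are needed: the explicit finite-rank operator meets it, and the
   specification fixes the Taylor coefficients of the image of every f in [H_d]. *)
#[local] Existing Instance summability.totally_filter.

(** * Unconditional sums of complex families, up to Fubini's theorem *)

Section Summation.
Context {R : realType}.
Local Notation C := (Cplx R).

(** [has_isum] over an arbitrary index type, because exchanging summations requires sums over pairs
    of indices. *)
Definition hsum (I : choiceType) (x : I -> C) (s : C) : Prop :=
  summability.partial_sum x @ summability.totally --> s.

Lemma hsumP (I : choiceType) (x : I -> C) s :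
  hsum x s <-> forall e : C, 0 < e -> exists J : {fset I},
    forall K : {fset I}, (J `<=` K)%fset -> `|\sum_(i <- K) x i - s| < e.
Proof.
split=> [xs e e0|H].
- have /cvgrPdist_lt/(_ e e0) := xs.
  case=> J _ HJ; exists J => K JK.
  by rewrite distrC; have := HJ K JK; rewrite /= /summability.partial_sum big_seq_fsetE.
- apply/cvgrPdist_lt => e e0; have [J HJ] := H e e0.
  exists J => // K JK /=; rewrite distrC.
  by have := HJ K JK; rewrite /summability.partial_sum big_seq_fsetE.
Qed.

Lemma hsum_unique (I : choiceType) (x : I -> C) s t :
  hsum x s -> hsum x t -> s = t.
Proof. by move=> xs xt; apply: (cvg_unique _ xs xt). Qed.

Lemma isum_eq d (x : mindex d -> C) s : hsum x s -> isum x = s.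
Proof. by move=> xs; apply: (cvg_lim _ xs). Qed.


Lemma sum_fset_sub (V : nmodType) (I : choiceType) (J K : {fset I}) (f : I -> V) :
  (J `<=` K)%fset -> \sum_(i <- J) f i = \sum_(i <- K | i \in J) f i.
Proof.
move=> JK; rewrite [RHS]big_mkcond -(big_fset_incl _ JK) => [|i _ /negbTE-> //].
by apply: eq_fbigr => i ->.
Qed.

Lemma sum_fsetX (V : nmodType) (I J : choiceType) (A : {fset I}) (B : {fset J})
    (f : I -> J -> V) :
  \sum_(p <- (A `*` B)%fset) f p.1 p.2 = \sum_(i <- A) \sum_(j <- B) f i j.
Proof.
rewrite (pair_big_dep_cond _ A (fun=> B) xpredT (fun _ => xpredT)) /=.
apply: eq_fbigl => -[i j]; rewrite in_fsetM /=; apply/andP/imfset2P => /=.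
  by move=> [iA jB]; exists i; rewrite ?inE ?iA //; exists j; rewrite ?inE ?jB.
by move=> [i' i'A [j' j'B [-> ->]]]; move: i'A j'B; rewrite !inE !andbT.
Qed.

Lemma ler_sum_fset (I : choiceType) (J K : {fset I}) (f : I -> C) :
  (J `<=` K)%fset -> (forall i, 0 <= f i) -> \sum_(i <- J) f i <= \sum_(i <- K) f i.
Proof.
move=> JK f0; rewrite (sum_fset_sub _ JK) [leRHS](bigID (fun i => i \in J)) /=.
by rewrite lerDl sumr_ge0.
Qed.

(** The order of [C] is only partial, so the sum is found in [R], as a supremum of finite sums of
    real parts. *)
Lemma nonneg_hsum (I : choiceType) (x : I -> C) (M : C) :
  (forall i, 0 <= x i) ->
  (forall K : {fset I}, \sum_(i <- K) x i <= M) -> exists s, hsum x s.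
Proof.
move=> x0 xM.
pose y i : R := complex.Re (x i).
have xE i : x i = (y i)%:C%C by rewrite RRe_real // ger0_real.
have SE (K : {fset I}) : \sum_(i <- K) x i = (\sum_(i <- K) y i)%:C%C.
  by rewrite rmorph_sum /=; apply: eq_bigr => i _; rewrite xE.
pose A := [set \sum_(i <- (K : {fset I})) y i | K in [set: {fset I}]].
have Ab : has_sup A.
  split; first by exists (\sum_(i <- (fset0%fset : {fset I})) y i), fset0.
  exists (complex.Re M) => _ [K _ <-].
  by have := xM K; rewrite SE lecE /= => /andP[].
exists (sup A)%:C%C; apply/hsumP => e e0.
have eE : e = (complex.Re e)%:C%C by rewrite RRe_real // gtr0_real.
have e0' : 0 < complex.Re e by move: e0; rewrite eE ltcR.
have [_ [J _ <-] HJ] := sup_adherent e0' Ab.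
exists J => K JK.
have KA : \sum_(i <- K) y i <= sup A by apply: ub_le_sup; [case: Ab|exists K].
have JKle : \sum_(i <- J) y i <= \sum_(i <- K) y i.
  by rewrite -lecR -!SE ler_sum_fset.
rewrite SE -rmorphB normc_def /= ?expr0n ?addr0 sqrtr_sqr ler0_norm ?subr_le0 //.
rewrite opprB eE ltcR; lra.
Qed.

(* Failing unifications would otherwise unfold to pairs of reals. *)
#[local] Opaque Cplx.

Lemma hsumD (I : choiceType) (x y : I -> C) s t :
  hsum x s -> hsum y t -> hsum (fun i => x i + y i) (s + t).
Proof.
move=> /hsumP xs /hsumP yt; apply/hsumP => e e0.
have e20 : 0 < e / 2 by rewrite divr_gt0.
have [J HJ] := xs _ e20; have [L HL] := yt _ e20.
exists (J `|` L)%fset => K /[1!fsubUset] /andP[JK LK].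
rewrite big_split /= opprD addrACA (splitr e).
by apply: (le_lt_trans (ler_normD _ _)); rewrite ltrD ?HJ ?HL.
Qed.

Lemma hsumZ (I : choiceType) (c : C) (x : I -> C) s :
  hsum x s -> hsum (fun i => c * x i) (c * s).
Proof.
move=> /hsumP xs; apply/hsumP => e e0.
have c0 : 0 < `|c| + 1 by rewrite ltr_wpDl.
have [J HJ] := xs (e / (`|c| + 1)) (divr_gt0 e0 c0).
exists J => K JK; rewrite -mulr_sumr -mulrBr normrM.
have := HJ K JK; rewrite ltr_pdivlMr // => h.
apply: le_lt_trans h; rewrite mulrC ler_wpM2l // lerDl ler01 //.
Qed.

Lemma hsum_fin (I : choiceType) (J : {fset I}) (x : I -> C) :
  (forall i, i \notin J -> x i = 0) -> hsum x (\sum_(i <- J) x i).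
Proof.
move=> x0; apply/hsumP => e e0; exists J => K JK.
by rewrite (big_fset_incl _ JK) ?subrr ?normr0 // => i _; exact: x0.
Qed.

Lemma hsum0 (I : choiceType) : hsum (fun _ : I => 0) 0.
Proof. by have := @hsum_fin I fset0%fset (fun=> 0) (fun _ _ => erefl); rewrite big1. Qed.

Lemma hsum1 (I : choiceType) (i : I) (x : I -> C) :
  (forall j, j != i -> x j = 0) -> hsum x (x i).
Proof.
move=> x0; have := @hsum_fin I [fset i]%fset x; rewrite big_seq_fset1; apply=> j.
by rewrite inE; exact: x0.
Qed.

Lemma hsum_sum (I : choiceType) (T : Type) (r : seq T) (P : pred T)
    (x : T -> I -> C) s :
  (forall t, hsum (x t) (s t)) ->
  hsum (fun i => \sum_(t <- r | P t) x t i) (\sum_(t <- r | P t) s t).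
Proof.
move=> xs; elim: r => [|t r IH].
  rewrite big_nil [X in hsum X](_ : _ = fun=> 0); first exact: hsum0.
  by apply/funext => i; rewrite big_nil.
rewrite big_cons; under eq_fun do rewrite big_cons.
by case: (P t); [exact: hsumD (xs t) IH|exact: IH].
Qed.

(** A real family y with |y| <= |x| is the difference of the nonnegative families |x| + y and |x|;
    this is applied to the real and imaginary parts of x. *)
Lemma bounded_hsum (I : choiceType) (x : I -> C) (M : C) :
  (forall K : {fset I}, \sum_(i <- K) `|x i| <= M) -> exists s, hsum x s.
Proof.
move=> xM.
have pos (y : I -> C) : (forall i, y i \is Num.real) ->
  (forall i, `|y i| <= `|x i|) -> exists s, hsum y s.
  move=> yR yx.
  have [s1 h1] := nonneg_hsum (fun i => normr_ge0 (x i)) xM.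
  have [||s2 h2] := @nonneg_hsum I (fun i => `|x i| + y i) (M + M).
  - move=> i; rewrite -[y i]opprK subr_ge0; apply: le_trans (yx i).
    by rewrite -normrN; apply: real_ler_norm; rewrite rpredN.
  - move=> K; rewrite big_split /= lerD //; apply: le_trans (xM K).
    apply: ler_sum => i _; apply: le_trans (yx i); exact: real_ler_norm.
  exists (s2 + (-1) * s1).
  rewrite (_ : y = fun i => (`|x i| + y i) + -1 * `|x i|).
    exact: hsumD h2 (hsumZ h1).
  by apply/funext => i; rewrite mulN1r addrC addKr.
have [||s1 h1] := pos (fun i => 'Re (x i)).
- by move=> i; apply: Creal_Re.
- by move=> i; rewrite leif_normC_Re_Creal.
have [||s2 h2] := pos (fun i => 'Im (x i)).
- by move=> i; apply: Creal_Im.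
- by move=> i; rewrite -normrN -ReMil -[leRHS]mul1r -(normCi C) -normrM leif_normC_Re_Creal.
exists (s1 + 'i * s2); rewrite (_ : x = fun i => 'Re (x i) + 'i * 'Im (x i)).
  exact: hsumD h1 (hsumZ h2).
by apply/funext => i; apply: Crect.
Qed.

Lemma hsum_close (I : choiceType) (x : I -> C) s t (M : C) (J : {fset I}) :
  hsum x s -> (forall K : {fset I}, (J `<=` K)%fset -> `|\sum_(i <- K) x i - t| <= M) ->
  `|s - t| <= M.
Proof.
move=> /hsumP xs xM; apply/ler_addgt0Pr => e e0.
have [L HL] := xs e e0.
have := HL (J `|` L)%fset (fsubsetUr _ _).
have := xM (J `|` L)%fset (fsubsetUl _ _).
set S := \sum_(i <- _) _ => h1 h2.
rewrite -(subrK S s) -addrA addrC; apply: le_trans (ler_normD _ _) _.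
by rewrite lerD // distrC ltW.
Qed.

Lemma hsum_norm_le (I : choiceType) (x : I -> C) s (M : C) :
  hsum x s -> (forall K : {fset I}, `|\sum_(i <- K) x i| <= M) -> `|s| <= M.
Proof.
move=> xs xM; rewrite -[s]subr0; apply: (hsum_close (J := fset0%fset) xs) => K _.
by rewrite subr0.
Qed.

Lemma hsum_tail (I : choiceType) (x : I -> C) s : hsum x s -> forall e : C, 0 < e ->
  exists J : {fset I}, forall K : {fset I}, [disjoint J & K]%fset ->
    `|\sum_(i <- K) x i| < e.
Proof.
move=> /hsumP xs e e0; have e20 : 0 < e / 2 by rewrite divr_gt0.
have [J HJ] := xs _ e20; exists J => K JK.
have := HJ _ (fsubsetUl J K); have := HJ _ (fsubset_refl J).
have -> : \sum_(i <- (J `|` K)%fset) x i = \sum_(i <- J) x i + \sum_(i <- K) x i.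
  rewrite [LHS](bigID (fun i => i \in J)) /= -sum_fset_sub ?fsubsetUl //.
  congr (_ + _); rewrite big_fset_condE; apply: eq_fbigl => i.
  rewrite !inE; case: (boolP (i \in J)) => //= iJ; rewrite ?andbF ?andbT //.
  by apply/esym/negbTE; move/fdisjointP: JK; apply.
set a := \sum_(i <- J) x i; set b := \sum_(i <- K) x i => h1 h2.
rewrite (_ : b = (a + b - s) - (a - s)); last by ring.
by rewrite [e]splitr; apply: le_lt_trans (ler_normB _ _) _; rewrite ltrD.
Qed.

(** A singleton outside the finite set given by [hsum_tail] is a tail, so all but finitely many
    terms are below 1. *)
Lemma hsum_bounded (I : choiceType) (x : I -> C) s : hsum x s ->
  exists M : C, forall i, `|x i| <= M.
Proof.
move=> xs; have [J HJ] := hsum_tail xs ltr01.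
have S0 : 0 <= \sum_(i <- J) `|x i| by apply: sumr_ge0.
exists (1 + \sum_(i <- J) `|x i|) => i.
have [iJ|iJ] := boolP (i \in J).
  rewrite (big_fsetD1 i) //= addrCA lerDl addr_ge0 // sumr_ge0 //.
rewrite ler_wpDr // ltW //; have := HJ [fset i]%fset; rewrite big_seq_fset1; apply.
by rewrite fdisjointX1.
Qed.

(** For a finite set of rows, a rectangle long enough in the other direction approximates the chosen
    row sums and, once it contains [J0], also the total [S]. *)
Lemma hsum_rows (I J : choiceType) (x : I -> J -> C) (r : I -> C) S :
  hsum (fun p : I * J => x p.1 p.2) S -> (forall i, hsum (x i) (r i)) -> hsum r S.
Proof.
move=> /hsumP xS xr; apply/hsumP => e e0; have e20 : 0 < e / 2 by rewrite divr_gt0.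
have [J0 HJ0] := xS _ e20.
pose A0 := [fset p.1 | p in J0]%fset; pose B0 := [fset p.2 | p in J0]%fset.
exists A0 => A A0A.
have /hsumP/(_ _ e20) [B1 HB1] := hsum_sum (r := A) (P := xpredT) xr.
have := HB1 (B0 `|` B1)%fset (fsubsetUr _ _).
rewrite exchange_big /= -sum_fsetX => h1.
have h2 : (J0 `<=` A `*` (B0 `|` B1))%fset.
  apply/fsubsetP => -[i j] ijJ; rewrite in_fsetM /= inE.
  rewrite (fsubsetP A0A) /=; last by apply/imfsetP; exists (i, j).
  by apply/orP; left; apply/imfsetP; exists (i, j).
have {h2} h2 := HJ0 _ h2.
set a := \sum_(i <- A) r i in h1 *; set b := \sum_(p <- _) _ in h1 h2.
rewrite (_ : a - S = (b - S) - (b - a)); last by ring.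
by rewrite [e]splitr; apply: le_lt_trans (ler_normB _ _) _; rewrite ltrD.
Qed.

(** [h] is injective and [y] vanishes off its image, so the two families differ only by zeros. *)
Lemma hsum_reindex (I J : choiceType) (h : I -> J) (g : J -> I) (y : J -> C) s :
  cancel h g -> (forall j, h (g j) <> j -> y j = 0) ->
  hsum (y \o h) s -> hsum y s.
Proof.
move=> hK y0 /hsumP ys; apply/hsumP => e e0; have [I0 HI0] := ys _ e0.
exists [fset h i | i in I0]%fset => K JK.
pose K1 := [fset j in K | h (g j) == j]%fset.
have gI : {in K1 &, injective g}.
  by move=> a b; rewrite !inE => /andP[_ /eqP {2}<-] /andP[_ /eqP {2}<-] ->.
suff -> : \sum_(i <- K) y i = \sum_(i <- [fset g j | j in K1]%fset) (y \o h) i.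
  apply: HI0; apply/fsubsetP => i iI; apply/imfsetP; exists (h i) => //=.
  by rewrite !inE hK eqxx andbT (fsubsetP JK) // in_imfset.
rewrite big_imfset //=; transitivity (\sum_(j <- K1) y j).
  apply/esym/big_fset_incl; first by apply/fsubsetP => j; rewrite !inE => /andP[].
  move=> j jK; rewrite !inE /= jK /= => /eqP; exact: y0.
by apply: eq_fbigr => j; rewrite !inE => /andP[_ /eqP ->].
Qed.

Lemma hsum_fubini (I J : choiceType) (x : I -> J -> C) (M : C) :
  (forall (A : {fset I}) (B : {fset J}), \sum_(i <- A) \sum_(j <- B) `|x i j| <= M) ->
  forall (r : I -> C) (c : J -> C), (forall i, hsum (x i) (r i)) ->
  (forall j, hsum (x ^~ j) (c j)) -> exists S, hsum r S /\ hsum c S.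
Proof.
move=> xM r c xr xc.
have [S hS] : exists S, hsum (fun p : I * J => x p.1 p.2) S.
  apply: (@bounded_hsum _ _ M) => K.
  pose A := [fset p.1 | p in K]%fset; pose B := [fset p.2 | p in K]%fset.
  apply: le_trans (xM A B); rewrite -(sum_fsetX _ _ (fun i j => `|x i j|)).
  apply: ler_sum_fset => //; apply/fsubsetP => -[i j] ijK; rewrite in_fsetM /=.
  by apply/andP; split; apply/imfsetP; exists (i, j).
exists S; split; first exact: hsum_rows hS xr.
apply: (hsum_rows (x := fun j i => x i j) (S := S)) xc.
pose h (p : I * J) := (p.2, p.1); pose g (p : J * I) := (p.2, p.1).
by apply: (@hsum_reindex _ _ h g); [case| case|exact: hS].
Qed.
End Summation.

#[local] Opaque Cplx.

(** * Multi-index sums, the binomial formula and re-expansion of power series *)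

Section MultiIndexSums.
Context {R : realType} {d : nat}.
Local Notation C := (Cplx R).
Implicit Types (n k m : mindex d) (K : {fset mindex d}).

Definition mle k n := [forall j, (k j <= n j)%N].
Definition msub n k : mindex d := [ffun j => (n j - k j)%N].
Definition mbin n k : nat := \prod_(j < d) 'C(n j, k j).
Definition absv (z : 'rV[C]_d) : 'rV[C]_d := \row_j `|z ord0 j|.

(** Cubes are cofinal among the finite sets of indices, and over them sums of products factor
    coordinatewise. *)
Definition cube (N : nat) : {fset mindex d} :=
  [fset ([ffun j => val (g j)] : mindex d) | g : {ffun 'I_d -> 'I_N} in {: {ffun 'I_d -> 'I_N}}]%fset.

Lemma in_cube N n : (n \in cube N) = [forall j, (n j < N)%N].
Proof.
apply/imfsetP/forallP => /= [[g _ ->] j|nN]; first by rewrite ffunE.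
by exists [ffun j => Ordinal (nN j)] => //; apply/ffunP => j; rewrite !ffunE.
Qed.

Lemma sub_cube K : exists N, (K `<=` cube N)%fset.
Proof.
exists (\sum_(n <- K) mdegree n).+1; apply/fsubsetP => n nK; rewrite in_cube.
apply/forallP => j; rewrite ltnS (big_fsetD1 n) //= /mdegree (bigD1 j) //=.
by rewrite -addnA leq_addr.
Qed.

Lemma sum_cube (phi : 'I_d -> nat -> C) N :
  \sum_(k <- cube N) \prod_j phi j (k j) = \prod_j \sum_(i < N) phi j i.
Proof.
rewrite bigA_distr_bigA /= big_imfset /=; last first.
  move=> g h _ _ /ffunP gh; apply/ffunP => j; apply: val_inj.
  by have := gh j; rewrite !ffunE.
rewrite (perm_big (index_enum _)) /=; last first.
  apply: uniq_perm; [exact: enum_uniq|exact: index_enum_uniq|move=> g].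
  by rewrite mem_enum mem_index_enum.
by under eq_bigr do under eq_bigr do rewrite ffunE.
Qed.

Lemma sum_prod_le (phi : nat -> C) (B : C) : (forall i, 0 <= phi i) ->
  (forall N, \sum_(i < N) phi i <= B) ->
  forall K, \sum_(k <- K) \prod_j phi (k j) <= B ^+ d.
Proof.
move=> phi0 phiB K; have [N KN] := sub_cube K.
apply: le_trans (ler_sum_fset KN _) _; first by move=> k; rewrite prodr_ge0.
rewrite (sum_cube (fun=> phi)) -[in leRHS](card_ord d) -prodr_const.
by apply: ler_prod => j _; rewrite phiB sumr_ge0.
Qed.

Lemma sum_geom_le (q : C) N : 0 <= q -> q < 1 -> \sum_(i < N) q ^+ i <= (1 - q)^-1.
Proof.
move=> q0 q1; have q1' : 0 < 1 - q by rewrite subr_gt0.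
by rewrite -[leRHS]mul1r ler_pdivlMr // mulrC -opprB mulNr -subrX1 opprB gerBl exprn_ge0.
Qed.

(** Partial sums of the derivative of the geometric series; the weight [i.+1] will absorb the
    polynomial loss in the estimate of 1 / beta(n). *)
Lemma sum_geom2_le (q : C) N : 0 <= q -> q < 1 ->
  \sum_(i < N) i.+1%:R * q ^+ i <= (1 - q)^-1 ^+ 2.
Proof.
move=> q0 q1; have q1' : 0 < 1 - q by rewrite subr_gt0.
have E : (1 - q) ^+ 2 * (\sum_(i < N) i.+1%:R * q ^+ i) =
    1 - q ^+ N * (1 + N%:R * (1 - q)).
  elim: N => [|N IH]; first by rewrite big_ord0; ring.
  by rewrite big_ord_recr /= mulrDr IH (exprS q) -natr1; ring.
rewrite exprVn -[leRHS]mul1r ler_pdivlMr ?exprn_gt0 // mulrC E gerBl.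
by rewrite mulr_ge0 ?exprn_ge0 // addr_ge0 // mulr_ge0 // ltW.
Qed.


Lemma mpower_absv (z : 'rV[C]_d) n : mpower (absv z) n = `|mpower z n|.
Proof. by rewrite normr_prod; apply: eq_bigr => j _; rewrite mxE normrX. Qed.

Lemma mpower_const (s : C) n : mpower (const_mx s) n = s ^+ mdegree n.
Proof. by rewrite -prodrXr; apply: eq_bigr => j _; rewrite mxE. Qed.

Lemma mpowerZ (s : C) (z : 'rV[C]_d) n : mpower (s *: z) n = s ^+ mdegree n * mpower z n.
Proof.
by rewrite -prodrXr -big_split /=; apply: eq_bigr => j _; rewrite mxE exprMn.
Qed.

Lemma mpowerM (z u : 'rV[C]_d) n :
  mpower (\row_j (z ord0 j * u ord0 j)) n = mpower z n * mpower u n.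
Proof. by rewrite -big_split /=; apply: eq_bigr => j _; rewrite mxE exprMn. Qed.

Lemma mpower_ge0 (r : 'rV[C]_d) n : (forall j, 0 <= r ord0 j) -> 0 <= mpower r n.
Proof. by move=> r0; apply: prodr_ge0 => j _; rewrite exprn_ge0. Qed.

Lemma ler_mpower (r s : 'rV[C]_d) n : (forall j, 0 <= r ord0 j <= s ord0 j) ->
  mpower r n <= mpower s n.
Proof.
move=> rs; apply: ler_prod => j _; have /andP[r0 rsj] := rs j.
by rewrite exprn_ge0 //= lerXn2r // nnegrE // (le_trans r0).
Qed.

Lemma mpower_msub (z : 'rV[C]_d) n k : mle k n ->
  mpower z (msub n k) * mpower z k = mpower z n.
Proof.
move/forallP => kn; rewrite -big_split /=; apply: eq_bigr => j _.
by rewrite ffunE -exprD subnK.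
Qed.

Lemma mbin_eq0 n k : ~~ mle k n -> mbin n k = 0%N.
Proof.
rewrite negb_forall => /existsP[j]; rewrite -ltnNge => nk.
by rewrite /mbin (bigD1 j) //= bin_small.
Qed.

(** Any cube containing n may index the expansion, because [mbin n k] vanishes unless k <= n; this
    also makes the truncated subtraction in [msub] harmless. *)
Lemma mpower_binomial (p w : 'rV[C]_d) n N : n \in cube N ->
  mpower (p + w) n =
  \sum_(k <- cube N) (mbin n k)%:R * mpower p (msub n k) * mpower w k.
Proof.
rewrite in_cube => /forallP nN.
pose phi j i : C := ('C(n j, i))%:R * p ord0 j ^+ (n j - i) * w ord0 j ^+ i.
transitivity (\sum_(k <- cube N) \prod_j phi j (k j)).
  rewrite sum_cube; apply: eq_bigr => j _; rewrite mxE exprDn.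
  rewrite (big_ord_widen _ (fun i => p ord0 j ^+ (n j - i) * w ord0 j ^+ i *+ 'C(n j, i)) (nN j)).
  rewrite big_mkcond /=; apply: eq_bigr => i _; rewrite /phi.
  case: ltnP => [_|ni]; first by rewrite -mulrA mulr_natl.
  by rewrite bin_small // !mul0r.
apply: eq_bigr => k _; rewrite !big_split /= natr_prod.
by congr (_ * _ * _); apply: eq_bigr => j _; rewrite ffunE.
Qed.

Lemma sum_binomial_le (p w : 'rV[C]_d) n K :
  (forall j, 0 <= p ord0 j) -> (forall j, 0 <= w ord0 j) ->
  \sum_(k <- K) (mbin n k)%:R * mpower p (msub n k) * mpower w k <= mpower (p + w) n.
Proof.
move=> p0 w0; have [N KN] := sub_cube (K `|` [fset n])%fset.
rewrite (mpower_binomial p w (N := N)); last first.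
  by rewrite (fsubsetP KN) // !inE eqxx orbT.
apply: ler_sum_fset; first by apply: fsubset_trans KN; exact: fsubsetUl.
by move=> k; rewrite !mulr_ge0 ?mpower_ge0.
Qed.

Lemma hsum_binomial (p w : 'rV[C]_d) n :
  hsum (fun k => (mbin n k)%:R * mpower p (msub n k) * mpower w k) (mpower (p + w) n).
Proof.
have [N] := sub_cube [fset n]%fset; rewrite fsub1set => nN.
rewrite (mpower_binomial p w nN); apply: hsum_fin => k kN.
rewrite mbin_eq0 ?mul0r //; apply: contra kN => /forallP kn.
move: nN; rewrite !in_cube => /forallP nN; apply/forallP => j.
exact: leq_ltn_trans (kn j) (nN j).
Qed.

(** [b] collects the coefficients of the series re-expanded about [p]. The absolute values of the
    double family are controlled by the series of [|a n|] at [absv p + absv w], so Fubini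
    applies. *)
Lemma hsum_reexpand (a b : mindex d -> C) (p w : 'rV[C]_d) (M : C) :
  (forall K, \sum_(n <- K) `|a n| * mpower (absv p + absv w) n <= M) ->
  (forall k, hsum (fun n => a n * (mbin n k)%:R * mpower p (msub n k)) (b k)) ->
  exists S, hsum (fun n => a n * mpower (p + w) n) S /\
            hsum (fun k => b k * mpower w k) S.
Proof.
move=> aM ab.
pose x n k : C := a n * ((mbin n k)%:R * mpower p (msub n k) * mpower w k).
have abs0 (z : 'rV[C]_d) j : 0 <= absv z ord0 j by rewrite mxE.
apply: (hsum_fubini (x := x) (M := M)).
- move=> A B; apply: le_trans (aM A); apply: ler_sum => n _.
  rewrite (eq_bigr (fun k => `|a n| *
    ((mbin n k)%:R * mpower (absv p) (msub n k) * mpower (absv w) k))).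
    by rewrite -mulr_sumr ler_wpM2l // sum_binomial_le.
  by move=> k _; rewrite !normrM normr_nat !mpower_absv.
- by move=> n; apply: hsumZ; apply: hsum_binomial.
- move=> k; rewrite mulrC.
  rewrite (_ : x^~ k = fun n => mpower w k * (a n * (mbin n k)%:R * mpower p (msub n k))).
    exact: hsumZ (ab k).
  by apply/funext => n; rewrite /x; ring.
Qed.

(** Up to the factor [s ^+ mdegree k], each binomial factor is a single term in the expansion of
    (|p| + s)^n. *)
Lemma hsum_reexpand_coef (a : mindex d -> C) (p : 'rV[C]_d) (s M : C) : 0 < s ->
  (forall K, \sum_(n <- K) `|a n| * mpower (absv p + const_mx s) n <= M) ->
  exists b, forall k, hsum (fun n => a n * (mbin n k)%:R * mpower p (msub n k)) (b k).
Proof.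
move=> s0 aM.
suff /choice[b hb] : forall k, exists b, hsum (fun n => a n * (mbin n k)%:R * mpower p (msub n k)) b.
  by exists b.
move=> k.
apply: (bounded_hsum (M := M / s ^+ mdegree k)) => K.
rewrite ler_pdivlMr ?exprn_gt0 // mulr_suml; apply: le_trans (aM K).
apply: ler_sum => n _; rewrite !normrM normr_nat -!mulrA ler_wpM2l //.
have abs0 j : 0 <= absv p ord0 j by rewrite mxE.
have c0 j : 0 <= (const_mx s : 'rV[C]_d) ord0 j by rewrite mxE ltW.
apply: le_trans (sum_binomial_le n [fset k]%fset abs0 c0).
by rewrite big_seq_fset1 mpower_const mpower_absv mulrA.
Qed.

End MultiIndexSums.

(** * Averages over roots of unity, Cauchy's inequality and uniqueness of coefficients *)

Lemma prim_root_exists (F : numClosedFieldType) n : (0 < n)%N ->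
  exists z : F, n.-primitive_root z.
Proof.
move=> n0; have [r rE] := closed_field_poly_normal ('X^n - 1 : {poly F}).
have {}rE : 'X^n - 1 = \prod_(z <- r) ('X - z%:P).
  by rewrite rE lead_coefXnsubC // scale1r.
have unity : all n.-unity_root r.
  by apply/allP => z; rewrite -root_prod_XsubC -rE.
have ur : uniq r.
  by rewrite -separable_prod_XsubC -rE separable_Xn_sub_1 // pnatr_eq0 -lt0n.
have sr : (n <= size r)%N by rewrite -ltnS -(size_prod_XsubC r id) -rE size_XnsubC.
by have /hasP[z _ zn] := has_prim_root n0 unity ur sr; exists z.
Qed.

Section Averaging.
Context {R : realType} {d : nat}.
Local Notation C := (Cplx R).
Implicit Types (n k m : mindex d) (K : {fset mindex d}).

(* Averaging [mpower u m]^-1 times the sum over the vectors u of N-th roots of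
   unity keeps exactly the coefficients with indices congruent to m mod N. *)
Lemma root_average (N : nat) (w : C) m n : (0 < N)%N -> N.-primitive_root w ->
  \sum_(g : {ffun 'I_d -> 'I_N})
    (mpower (\row_j w ^+ g j) m)^-1 * mpower (\row_j w ^+ g j) n =
  N%:R ^+ d * ([forall j, n j == m j %[mod N]])%:R.
Proof.
move=> N0 wN; have w0 : w != 0.
  apply/eqP => w0; have /eqP := prim_expr_order wN.
  by rewrite w0 expr0n gtn_eqF // eq_sym oner_eq0.
transitivity (\sum_(g : {ffun 'I_d -> 'I_N}) \prod_j (w ^+ n j / w ^+ m j) ^+ g j).
  apply: eq_bigr => g _; rewrite /mpower -prodfV -big_split /=; apply: eq_bigr => j _.
  by rewrite mxE exprMn exprVn mulrC -!exprM ![(g j * _)%N]mulnC.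
rewrite -(bigA_distr_bigA (fun j (i : 'I_N) => (w ^+ n j / w ^+ m j) ^+ i)) /=.
have S j : \sum_(i < N) (w ^+ n j / w ^+ m j) ^+ i = N%:R * (n j == m j %[mod N])%:R.
  set z := _ / _; have zE : (z == 1) = (n j == m j %[mod N]).
    by rewrite -(eq_prim_root_expr wN) -(inj_eq (mulIf (expf_neq0 (m j) w0)))
      divfK ?expf_neq0 // mul1r.
  rewrite -zE; have [->|z1] := eqVneq z 1.
    by rewrite (eq_bigr (fun=> 1)) ?sumr_const ?card_ord ?mulr1 // => i _; rewrite expr1n.
  have /eqP : (z - 1) * (\sum_(i < N) z ^+ i) = 0.
    rewrite -subrX1 /z exprMn exprVn -!exprM !(mulnC _ N) !exprM.
    by rewrite (prim_expr_order wN) !expr1n invr1 mulr1 subrr.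
  by rewrite mulf_eq0 subr_eq0 (negbTE z1) => /eqP ->; rewrite mulr0.
under eq_bigr do rewrite S.
rewrite big_split /= prodr_const card_ord; congr (_ * _).
case: (boolP [forall j, n j == m j %[mod N]]) => [/forallP H|/forallPn [j nj]].
  by rewrite big1 // => j _; rewrite H.
by rewrite (bigD1 j) //= (negbTE nj) mul0r.
Qed.

(** The substitute for integration over the torus: averaging over roots of unity of order N+1 leaves
    [x m] plus an aliased tail over the other indices congruent to m, which is small for large N. *)
Lemma coef_average_le (x : mindex d -> C) (M : C) m :
  (forall u : 'rV[C]_d, (forall j, `|u ord0 j| = 1) ->
     exists2 v, hsum (fun n => x n * mpower u n) v & `|v| <= M) ->
  `|x m| <= M.
Proof.
move=> H.
have /choice[v hv] : forall u : 'rV[C]_d, exists v, (forall j, `|u ord0 j| = 1) ->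
     hsum (fun n => x n * mpower u n) v /\ `|v| <= M.
  move=> u; have [/H[v h1 h2]|nu] := pselect (forall j, `|u ord0 j| = 1); first by exists v.
  by exists 0.
have [s xs] : exists s, hsum x s.
  have [|v0 h _] := H (const_mx 1); first by move=> j; rewrite mxE normr1.
  exists v0; rewrite (_ : x = fun n => x n * mpower (const_mx 1) n) //.
  by apply/funext => n; rewrite mpower_const expr1n mulr1.
apply/ler_addgt0Pr => e e0; have [J HJ] := hsum_tail xs e0.
have [N] := sub_cube (J `|` [fset m])%fset; rewrite fsubUset fsub1set => /andP[JN mN].
have [w wN] := @prim_root_exists C N.+1 (ltn0Sn N).
pose u (g : {ffun 'I_d -> 'I_N.+1}) : 'rV[C]_d := \row_j w ^+ g j.
have w1 : `|w| = 1.
  apply/eqP; rewrite -(@pexpr_eq1 _ _ N.+1) //.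
  by rewrite -normrX (prim_expr_order wN) normr1.
have u1 g j : `|u g ord0 j| = 1 by rewrite mxE normrX w1 expr1n.
have u1' g k : `|mpower (u g) k| = 1.
  by rewrite normr_prod big1 // => j _; rewrite normrX u1 expr1n.
pose A : C := (N.+1%:R ^+ d)^-1 * \sum_g (mpower (u g) m)^-1 * v (u g).
have N0 : 0 < N.+1%:R ^+ d :> C by rewrite exprn_gt0.
have AM : `|A| <= M.
  rewrite normrM (gtr0_norm (x := _^-1)) ?invr_gt0 // mulrC ler_pdivrMr //.
  apply: le_trans (ler_norm_sum _ _ _) _.
  apply: le_trans (ler_sum _ (G := fun=> M) _) _.
    by move=> g _; rewrite normrM normfV u1' invr1 mul1r; case: (hv (u g) (u1 g)).
  by rewrite sumr_const card_ffun !card_ord -natrX mulr_natr.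
pose y n := x n * ([forall j, n j == m j %[mod N.+1]])%:R.
have yA : hsum y A.
  rewrite (_ : y = fun n => (N.+1%:R ^+ d)^-1 *
     \sum_g (mpower (u g) m)^-1 * (x n * mpower (u g) n)).
    apply: hsumZ; apply: hsum_sum => g; apply: hsumZ.
    by case: (hv (u g) (u1 g)).
  apply/funext => n; under eq_bigr do rewrite mulrCA.
  rewrite -mulr_sumr root_average // mulrCA; congr (_ * _).
  by rewrite mulKf // gt_eqF.
have yx : `|A - x m| <= e.
  apply: (hsum_close (J := [fset m]%fset) yA) => K; rewrite fsub1set => mK.
  have ym : y m = x m by rewrite /y (introT forallP) ?mulr1.
  rewrite (big_fsetD1 m) //= ym addrAC subrr add0r.
  (* An index in [J] congruent to m modulo N+1 equals m, since both lie in [cube N]; so [L] avoids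
     [J] and its sum is small. *)
  pose L := [fset k in (K `\ m)%fset | [forall j, k j == m j %[mod N.+1]]]%fset.
  suff -> : \sum_(k <- (K `\ m)%fset) y k = \sum_(k <- L) x k.
    apply/ltW/HJ/fdisjointP => k kJ; rewrite !inE; apply/negP => /andP[/andP[km _]].
    move/forallP => kmj; case/eqP: km; apply/ffunP => j.
    have := fsubsetP JN _ kJ; rewrite !in_cube in mN * => /forallP/(_ j) kN.
    by have /eqP := kmj j; rewrite !modn_small // ltnW ?ltnS //; exact: (forallP mN j).
  rewrite -big_fset_condE [RHS]big_mkcond /=; apply: eq_fbigr => k _ _; rewrite /y.
  by case: ifP; rewrite ?mulr1 ?mulr0.
rewrite -(subrK A (x m)); apply: le_trans (ler_normD _ _) _.
by rewrite addrC distrC lerD.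
Qed.

Lemma cauchy_coef (a : mindex d -> C) (f : 'rV[C]_d -> C) (r : 'rV[C]_d) (M : C) m :
  (forall j, 0 <= r ord0 j) ->
  (forall z : 'rV[C]_d, (forall j, `|z ord0 j| = r ord0 j) ->
     hsum (fun n => a n * mpower z n) (f z) /\ `|f z| <= M) ->
  `|a m| * mpower r m <= M.
Proof.
move=> r0 H; rewrite -[mpower r m]ger0_norm ?mpower_ge0 // -normrM.
apply: (coef_average_le (x := fun n => a n * mpower r n)) => u u1.
have [|h1 h2] := H (\row_j (r ord0 j * u ord0 j)).
  by move=> j; rewrite mxE normrM u1 mulr1 ger0_norm.
exists (f (\row_j (r ord0 j * u ord0 j))) => //.
rewrite (_ : (fun n => _) = fun n => a n * mpower (\row_j (r ord0 j * u ord0 j)) n) //.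
by apply/funext => n; rewrite mpowerM mulrA.
Qed.

(** Cauchy's inequality for the difference of the two series, with bound 0. *)
Lemma coef_unique (a b : mindex d -> C) (s : C) : 0 < s ->
  (forall z : 'rV[C]_d, (forall j, `|z ord0 j| = s) -> exists v,
     hsum (fun n => a n * mpower z n) v /\ hsum (fun n => b n * mpower z n) v) ->
  a = b.
Proof.
move=> s0 H; apply/funext => m; apply/eqP; rewrite -subr_eq0 -normr_le0.
rewrite -(pmulr_lle0 _ (exprn_gt0 (mdegree m) s0)) -mpower_const.
apply: (cauchy_coef (a := fun m => a m - b m) (f := fun=> 0)) => [j|z zs].
  by rewrite mxE ltW.
rewrite normr0; split=> //.
have [|v [h1 h2]] := H z; first by move=> j; rewrite zs mxE.
rewrite -(subrr v) -[X in _ - X]mul1r -mulNr.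
rewrite (_ : (fun n => _) = fun n => a n * mpower z n + -1 * (b n * mpower z n)).
  exact: hsumD h1 (hsumZ h2).
by apply/funext => n; rewrite mulN1r mulrBl.
Qed.

End Averaging.

(** * Compactness of the closed Euclidean ball *)

Section Compactness.
Context {R : realType}.
Local Notation C := (Cplx R).

Lemma cplx_real (c : C) : c \is Num.real -> c = (complex.Re c)%:C%C.
Proof. by move=> cR; rewrite RRe_real. Qed.

Lemma cplx_arch (c : C) : exists n : nat, `|c| <= n%:R.
Proof.
exists (Num.truncn (complex.Re `|c|)).+1.
rewrite (cplx_real (normr_real c)) -(rmorph_nat (real_complex R)) lecR ltW //.
exact: truncnS_gt.
Qed.

Lemma continuous_cplx : continuous (fun p : R * R => (p.1 +i* p.2)%C : C).
Proof.
move=> [x y]; apply/cvgrPdist_lt => e e0.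
have eE : e = (complex.Re e)%:C%C := cplx_real (gtr0_real e0).
have e20 : 0 < complex.Re e / 2 by rewrite divr_gt0 //; move: e0; rewrite eE ltcR.
near=> p.
have -> : ((x, y).1 +i* (x, y).2)%C - (p.1 +i* p.2)%C = (x - p.1)%:C%C + 'i%C * (y - p.2)%:C%C :> C.
  by apply/eqP; rewrite eq_complex /=; apply/andP; split; apply/eqP; ring.
apply: le_lt_trans (ler_normD _ _) _.
rewrite normrM !normc_def /= !expr0n !addr0 add0r expr1n sqrtr1 mul1r !sqrtr_sqr.
rewrite -rmorphD eE ltcR [ltRHS]splitr ltrD //; near: p.
  by have /cvgrPdist_lt/(_ _ e20) : fst @ nbhs (x, y) --> x by exact: cvg_fst.
by have /cvgrPdist_lt/(_ _ e20) : snd @ nbhs (x, y) --> y by exact: cvg_snd.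
Unshelve. all: by end_near.
Qed.

Lemma Re_continuous : continuous (fun z : C => complex.Re z : R).
Proof.
move=> z; have FF : Filter (nbhs z) by exact: nbhs_filter.
apply/(@cvgrPdist_lt _ _ _ (nbhs z) FF) => e e0.
have e0' : 0 < e%:C%C :> C by rewrite ltcR.
apply/nbhs_ballP; exists e%:C%C => // w; rewrite -ball_normE /= normc_def ltcR; apply: le_lt_trans.
by case: z w {FF} => a b [a' b'] /=; rewrite -sqrtr_sqr ler_wsqrtr // lerDl sqr_ge0.
Qed.

Lemma Im_continuous : continuous (fun z : C => complex.Im z : R).
Proof.
move=> z; have FF : Filter (nbhs z) by exact: nbhs_filter.
apply/(@cvgrPdist_lt _ _ _ (nbhs z) FF) => e e0.
have e0' : 0 < e%:C%C :> C by rewrite ltcR.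
apply/nbhs_ballP; exists e%:C%C => // w; rewrite -ball_normE /= normc_def ltcR; apply: le_lt_trans.
by case: z w {FF} => a b [a' b'] /=; rewrite -sqrtr_sqr ler_wsqrtr // lerDr sqr_ge0.
Qed.

(** The ball is closed in a product of compact squares; [g] is a real-valued copy of [sqnorm], so
    that closedness follows from continuity. *)
Lemma compact_closed_ball_d d : compact (@closed_ball_d R d).
Proof.
pose sq : set C := (fun p : R * R => (p.1 +i* p.2)%C : C) @` (`[-1, 1] `*` `[-1, 1]).
have sqc : compact sq.
  apply: continuous_compact; last by apply: compact_setX; exact: segment_compact.
  by apply: continuous_subspaceT; exact: continuous_cplx.
pose g (z : 'rV[C]_d) : R :=
  \sum_j (complex.Re (z ord0 j) ^+ 2 + complex.Im (z ord0 j) ^+ 2).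
have gE z : sqnorm z = (g z)%:C%C.
  by rewrite rmorph_sum; apply: eq_bigr => j _; exact/esym/add_Re2_Im2.
have gc : continuous g.
  move=> z; have FF : Filter (nbhs z) by exact: nbhs_filter.
  pose h j (z : 'rV[C]_d) : R := complex.Re (z ord0 j) ^+ 2 + complex.Im (z ord0 j) ^+ 2.
  suff H (r : seq 'I_d) : \sum_(j <- r) h j y @[y --> z] --> \sum_(j <- r) h j z by exact: H.
  elim: r => [|j r IH].
    by rewrite big_nil; under eq_cvg do rewrite big_nil; exact: cvg_cst.
  rewrite big_cons; under eq_cvg do rewrite big_cons.
  have cz : (fun z : 'rV[C]_d => z ord0 j) @ z --> z ord0 j by exact: coord_continuous.
  have re := cvg_comp _ _ cz (@Re_continuous (z ord0 j)).
  have im := cvg_comp _ _ cz (@Im_continuous (z ord0 j)).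
  apply: (@cvgD _ _ _ (nbhs z) FF _ _ _ _ _ IH).
  apply: (@cvgD _ _ _ (nbhs z) FF).
    exact: (@cvgM _ _ (nbhs z) FF _ _ _ _ re re).
  exact: (@cvgM _ _ (nbhs z) FF _ _ _ _ im im).
apply: (@subclosed_compact _ _ [set z : 'rV[C]_d | forall j, sq (z ord0 j)]).
- rewrite (_ : closed_ball_d = g @^-1` [set x | x <= 1]).
    by apply: closed_comp => [z _|]; [exact: gc|exact: closed_le].
  by apply/seteqP; split => z /=; rewrite /closed_ball_d /= gE lecR.
- exact: (@rV_compact _ _ (fun=> sq)).
- move=> z; rewrite /closed_ball_d /= gE lecR => g1 j.
  exists (complex.Re (z ord0 j), complex.Im (z ord0 j)); last by case: (z ord0 j).
  have h : complex.Re (z ord0 j) ^+ 2 + complex.Im (z ord0 j) ^+ 2 <= 1.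
    apply: le_trans g1; rewrite /g (bigD1 j) //= lerDl sumr_ge0 // => i _.
    by rewrite addr_ge0 ?sqr_ge0.
  split; rewrite /= in_itv /= -ler_norml -(@expr_le1 _ 2) // real_normK ?num_real //.
    by apply: le_trans h; rewrite lerDl sqr_ge0.
  by apply: le_trans h; rewrite lerDr sqr_ge0.
Qed.

End Compactness.

(** * Local expansions with a uniform radius and a uniform bound *)

Section LocalExpansions.
Context {R : realType} {d : nat}.
Local Notation C := (Cplx R).
Implicit Types (n k m : mindex d) (K : {fset mindex d}) (a c : mindex d -> C).

(** Abel's lemma: terms bounded at [rho] are dominated at [l *: rho] by a product of d geometric
    series. *)
Lemma abs_bound_geom a (rho z : 'rV[C]_d) (l M : C) : 0 <= l -> l < 1 ->
  (forall n, `|a n| * mpower rho n <= M) ->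
  (forall j, 0 <= z ord0 j <= l * rho ord0 j) ->
  forall K, \sum_(n <- K) `|a n| * mpower z n <= M * (1 - l)^-1 ^+ d.
Proof.
move=> l0 l1 aM zrho K.
pose phi i := l ^+ i.
have phiE n : \prod_j phi (n j) = l ^+ mdegree n by rewrite prodrXr.
have M0 : 0 <= M.
  apply: le_trans (aM 0); rewrite mulr_ge0 // /mpower big1 // => j _.
  by rewrite ffunE expr0.
apply: (@le_trans _ _ (M * \sum_(n <- K) \prod_j phi (n j))).
  rewrite mulr_sumr; apply: ler_sum => n _; rewrite phiE.
  apply: le_trans (ler_wpM2r (exprn_ge0 _ l0) (aM n)).
  rewrite -mulrA ler_wpM2l // mulrC -mpowerZ; apply: ler_mpower => j.
  by rewrite mxE zrho.
apply: ler_wpM2l => //; apply: sum_prod_le => [i|N]; first by rewrite exprn_ge0.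
exact: sum_geom_le.
Qed.

Lemma hsum_mpower_norm_le a (z : 'rV[C]_d) s M :
  hsum (fun n => a n * mpower z n) s ->
  (forall K, \sum_(n <- K) `|a n| * mpower (absv z) n <= M) -> `|s| <= M.
Proof.
move=> zs aM; apply: (hsum_norm_le zs) => K; apply: le_trans (aM K).
apply: le_trans (ler_norm_sum _ _ _) _.
by under eq_bigr do rewrite normrM -mpower_absv.
Qed.

Lemma ler_sum_abs a (y z : 'rV[C]_d) M :
  (forall j, 0 <= y ord0 j <= z ord0 j) ->
  (forall K, \sum_(n <- K) `|a n| * mpower z n <= M) ->
  forall K, \sum_(n <- K) `|a n| * mpower y n <= M.
Proof.
move=> yz aM K; apply: le_trans (aM K); apply: ler_sum => n _.
by rewrite ler_wpM2l // ler_mpower.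
Qed.

(** The quarters keep the coordinates of p - q + w within eta / 2, where Abel's lemma with ratio 1/2
    gives a bound that does not depend on p. *)
Lemma reexpand_near (F : 'rV[C]_d -> C) c (q : 'rV[C]_d) (eta : C) : 0 < eta ->
  (forall w : 'rV[C]_d, (forall j, `|w ord0 j| <= eta) ->
     hsum (fun n => c n * mpower w n) (F (q + w))) ->
  exists M : C, forall p : 'rV[C]_d, (forall j, `|p ord0 j - q ord0 j| <= eta / 4) ->
  exists b, forall w : 'rV[C]_d, (forall j, `|w ord0 j| <= eta / 4) ->
    hsum (fun k => b k * mpower w k) (F (p + w)) /\ `|F (p + w)| <= M.
Proof.
move=> eta0 H.
have [|M0 HM0] := hsum_bounded (H (const_mx eta) _).
  by move=> j; rewrite mxE gtr0_norm.
have cM n : `|c n| * mpower (const_mx eta) n <= M0.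
  have := HM0 n; rewrite normrM -mpower_absv.
  rewrite (_ : absv _ = const_mx eta) //; apply/rowP => j.
  by rewrite !mxE gtr0_norm.
have i2 : (2^-1 : C) < 1 by rewrite invf_lt1 ?ltr1n.
pose M := M0 * (1 - 2^-1)^-1 ^+ d.
have bd : forall K, \sum_(n <- K) `|c n| * mpower (const_mx (eta / 2)) n <= M.
  apply: (abs_bound_geom _ i2 cM); first by rewrite invr_ge0.
  by move=> j; rewrite !mxE mulrC lexx andbT mulr_ge0 // ltW.
have eta4 : 0 < eta / 4 by rewrite divr_gt0.
have sum4 : eta / 4 + eta / 4 = eta / 2 by field.
exists M => p pq.
have [b hb] : exists b, forall k, hsum (fun n => c n * (mbin n k)%:R * mpower (p - q) (msub n k)) (b k).
  apply: (hsum_reexpand_coef (M := M) eta4); apply: ler_sum_abs bd => j.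
  by rewrite !mxE -sum4 addr_ge0 ?(ltW eta4) //= lerD2r.
exists b => w weta.
have bw : forall j, 0 <= (absv (p - q) + absv w) ord0 j <= (const_mx (eta / 2) : 'rV[C]_d) ord0 j.
  by move=> j; rewrite !mxE addr_ge0 //= -sum4 lerD.
have [S [h1 h2]] := hsum_reexpand (ler_sum_abs bw bd) hb.
have pwE : p + w = q + (p - q + w) by rewrite addrA (addrC q) subrK.
have small : forall j, 0 <= absv (p - q + w) ord0 j <= (const_mx (eta / 2) : 'rV[C]_d) ord0 j.
  move=> j; have /andP[_] := bw j; rewrite !mxE normr_ge0 /=.
  by apply: le_trans; apply: ler_normD.
have SE : S = F (p + w).
  apply: hsum_unique h1 _; rewrite pwE; apply: H => j.
  have /andP[_] := small j; rewrite !mxE => /le_trans; apply.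
  by rewrite ler_pdivrMr // ler_peMr ?ler1n // ltW.
rewrite -SE; split => //.
exact: hsum_mpower_norm_le h1 (ler_sum_abs small bd).
Qed.

(** One N controls both the radius and the bound, so the property persists as N grows, and
    compactness in its near-covering form applies to the filter of large N. *)
Lemma uniform_expansion (U : set 'rV[C]_d) (F : 'rV[C]_d -> C) : open U ->
  closed_ball_d `<=` U -> holomorphic_on U F ->
  exists N : nat, forall p, closed_ball_d p -> exists c,
    forall w : 'rV[C]_d, (forall j, `|w ord0 j| <= N.+1%:R^-1) ->
      hsum (fun k => c k * mpower w k) (F (p + w)) /\ `|F (p + w)| <= N.+1%:R.
Proof.
move=> Uo BU hF.
pose P (N : nat) (p : 'rV[C]_d) := exists c,
    forall w : 'rV[C]_d, (forall j, `|w ord0 j| <= N.+1%:R^-1) ->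
      hsum (fun k => c k * mpower w k) (F (p + w)) /\ `|F (p + w)| <= N.+1%:R.
have /compact_near_coveringP cov := @compact_closed_ball_d R d.
have [] := cov nat \oo P _; last by move=> N _ /(_ N (leqnn N)); exists N.
move=> q Bq; have [c /nbhs_ballP[e e0 He]] := hF q (BU q Bq).
have e20 : 0 < e / 2 by rewrite divr_gt0.
have [|M HM] := @reexpand_near F c q (e / 2) e20.
  move=> w we; have := He (q + w); rewrite /= (addrAC q) subrr add0r; apply.
  split => // i j; rewrite (ord1 i) -ball_normE /= !mxE opprD addNKr normrN.
  by apply: le_lt_trans (we j) _; rewrite gtr_pMr // invf_lt1 ?ltr1n.
have e80 : 0 < e / 2 / 4 by rewrite divr_gt0.
have [n1 hn1] := cplx_arch (e / 2 / 4)^-1; have [n2 hn2] := cplx_arch M.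
exists (ball q (e / 2 / 4), [set N | (maxn n1 n2 <= N)%N]) => /=.
  by split; [exact: nbhsx_ballx|exists (maxn n1 n2)].
move=> [p N] [/= [_ pq] N12].
have [|c' hc'] := HM p; first by move=> j; have := pq ord0 j; rewrite -ball_normE /= distrC => /ltW.
exists c' => w wN; have [|h1 h2] := hc' w.
  move=> j; apply: le_trans (wN j) _; rewrite -[leRHS]invrK lef_pV2 ?posrE ?invr_gt0 //.
  rewrite -[leLHS]gtr0_norm ?invr_gt0 //; apply: le_trans hn1 _.
  by rewrite ler_nat (leq_trans _ (leqW N12)) // leq_maxl.
have M0 : 0 <= M := le_trans (normr_ge0 _) h2.
split; first exact: h1.
apply: le_trans h2 _; rewrite -[leLHS]ger0_norm //.
by apply: le_trans hn2 _; rewrite ler_nat (leq_trans _ (leqW N12)) // leq_maxr.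
Qed.

End LocalExpansions.

(** * Growth of the domain of convergence at 0 beyond the unit ball *)

Section GlobalExpansion.
Context {R : realType} {d : nat}.
Local Notation C := (Cplx R).
Implicit Types (n k m : mindex d) (K : {fset mindex d}) (a b c : mindex d -> C).

Lemma sqnorm_ge0 (z : 'rV[C]_d) : 0 <= sqnorm z.
Proof. by apply: sumr_ge0 => j _; rewrite exprn_ge0. Qed.

Lemma sqnormZ (l : C) (z : 'rV[C]_d) : sqnorm (l *: z) = `|l| ^+ 2 * sqnorm z.
Proof. by rewrite mulr_sumr; apply: eq_bigr => j _; rewrite mxE normrM exprMn. Qed.

Lemma ler_sqnorm (y z : 'rV[C]_d) :
  (forall j, `|y ord0 j| <= `|z ord0 j|) -> sqnorm y <= sqnorm z.
Proof. by move=> yz; apply: ler_sum => j _; rewrite lerXn2r ?nnegrE. Qed.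

Lemma sqnorm_coord_le (z : 'rV[C]_d) (t : C) j : 0 <= t ->
  sqnorm z <= t ^+ 2 -> `|z ord0 j| <= t.
Proof.
move=> t0 zt; rewrite -(ler_pXn2r (n := 2)) ?nnegrE //; apply: le_trans zt.
by rewrite /sqnorm (bigD1 j) //= lerDl sumr_ge0 // => i _; rewrite exprn_ge0.
Qed.

Lemma sqnorm_thicken (p : 'rV[C]_d) (T e : C) : 0 < e -> sqnorm p < T ->
  exists2 s : C, 0 < s <= e & sqnorm (absv p + const_mx s) < T.
Proof.
move=> e0 pT; pose g := T - sqnorm p; have g0 : 0 < g by rewrite subr_gt0.
pose B : C := 2 * (\sum_j `|p ord0 j|) + d%:R + 1.
have S0 : 0 <= 2 * (\sum_j `|p ord0 j|) + d%:R :> C.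
  by rewrite addr_ge0 // mulr_ge0 // sumr_ge0.
have B0 : 0 < B by rewrite ltr_wpDl.
have B1 : 1 <= B by rewrite lerDr.
have g1 : 0 < 1 + g by rewrite addr_gt0.
have e1 : 0 < 1 + e by rewrite addr_gt0.
(* x / (1 + x) stands in for the minimum of x and 1; [B] dominates the increment of the squared norm
   divided by s when s <= 1. *)
pose s := (g / (1 + g)) * (e / (1 + e)) / B.
have gg : g / (1 + g) <= g by rewrite ler_pdivrMr // ler_peMr ?lerDl ?ltW.
have g11 : g / (1 + g) <= 1 by rewrite ler_pdivrMr // mul1r lerDr.
have ee : e / (1 + e) <= e by rewrite ler_pdivrMr // ler_peMr ?lerDl ?ltW.
have e11 : e / (1 + e) <= 1 by rewrite ler_pdivrMr // mul1r lerDr.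
have gp : 0 < g / (1 + g) by rewrite divr_gt0.
have ep : 0 < e / (1 + e) by rewrite divr_gt0.
have s0 : 0 < s by rewrite divr_gt0 // mulr_gt0.
have B1' : B^-1 <= 1 by rewrite invf_le1.
have Bi : 0 < B^-1 by rewrite invr_gt0.
have se' : s <= e / (1 + e).
  have ge0 := mulr_gt0 gp ep; rewrite /s.
  by apply: le_trans (ler_piMr (ltW ge0) B1') (ler_piMl (ltW ep) g11).
have se : s <= e := le_trans se' ee.
have s1 : s <= 1 := le_trans se' e11.
have sB : s * B <= g.
  by rewrite /s mulfVK ?gt_eqF //; apply: le_trans (ler_piMr (ltW gp) e11) gg.
exists s; first by rewrite s0.
have -> : sqnorm (absv p + const_mx s) =
    sqnorm p + s * (2 * (\sum_j `|p ord0 j|) + d%:R * s).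
  rewrite /sqnorm (eq_bigr (fun j => `|p ord0 j| ^+ 2 + (s * 2 * `|p ord0 j| + s * s))).
    by rewrite !big_split /= -mulr_sumr sumr_const card_ord -[s * s *+ d]mulr_natl; ring.
  by move=> j _; rewrite !mxE ger0_norm ?addr_ge0 // ?ltW //; ring.
rewrite -ltrBrDl; apply: lt_le_trans sB; rewrite ltr_pM2l //.
apply: le_lt_trans (_ : 2 * (\sum_j `|p ord0 j|) + d%:R < B); last by rewrite ltrDl.
by rewrite lerD2l ler_piMr.
Qed.

Definition coef_bound a (t M : C) := forall rho : 'rV[C]_d,
  (forall j, 0 <= rho ord0 j) -> sqnorm rho <= t ^+ 2 ->
  forall n, `|a n| * mpower rho n <= M.

Lemma coef_bound_sum a (t M : C) (y : 'rV[C]_d) : 0 < t -> coef_bound a t M ->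
  (forall j, 0 <= y ord0 j) -> sqnorm y < t ^+ 2 ->
  exists M', forall K, \sum_(n <- K) `|a n| * mpower y n <= M'.
Proof.
move=> t0 aM y0 yt; have t20 : 0 < t ^+ 2 by rewrite exprn_gt0.
pose x := sqnorm y / t ^+ 2; have x0 : 0 <= x by rewrite divr_ge0 ?sqnorm_ge0 // ltW.
have x1 : x < 1 by rewrite ltr_pdivrMr // mul1r.
(* By the inequality of arithmetic and geometric means l^2 >= x, so [l^-1 *: y] stays in the ball of
   radius t while l < 1; no square root is taken. *)
pose l := (1 + x) / 2; have l0 : 0 < l by rewrite divr_gt0 // ltr_pwDl.
have l1 : l < 1 by rewrite ltr_pdivrMr // mul1r -[ltRHS]/(1 + 1) ltrD2l.
have xl : x <= l ^+ 2.
  rewrite -subr_ge0 (_ : _ - _ = ((1 - x) / 2) ^+ 2); last by rewrite /l; field.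
  by rewrite exprn_ge0 // divr_ge0 // subr_ge0 ltW.
exists (M * (1 - l)^-1 ^+ d).
apply: (abs_bound_geom (rho := l^-1 *: y)) (ltW l0) l1 _ _; last first.
  by move=> j; rewrite mxE mulVKf ?gt_eqF // lexx andbT.
apply: aM => [j|]; first by rewrite mxE mulr_ge0 // invr_ge0 ltW.
rewrite sqnormZ normfV (gtr0_norm l0) exprVn mulrC ler_pdivrMr ?exprn_gt0 //.
by rewrite mulrC -ler_pdivrMr.
Qed.

Variables (F : 'rV[C]_d -> C) (N : nat).
Let M : C := N.+1%:R.
Let delta : C := N.+1%:R^-1.
Hypothesis HF : forall p, closed_ball_d p -> exists c,
  forall w : 'rV[C]_d, (forall j, `|w ord0 j| <= delta) ->
    hsum (fun k => c k * mpower w k) (F (p + w)) /\ `|F (p + w)| <= M.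

Let delta0 : 0 < delta. Proof. by rewrite invr_gt0. Qed.

(** The identity is asked only in the closed unit ball, the set of centres at which [HF] provides
    expansions. *)
Definition sums_to a (t : C) := forall z : 'rV[C]_d, sqnorm z < t ^+ 2 ->
  sqnorm z <= 1 -> hsum (fun n => a n * mpower z n) (F z).

(** On a small torus about p the re-expanded series and the local one of [HF] both sum to F, hence
    they coincide, and the former inherits the radius [delta] and the Cauchy bound [M]. The
    condition t <= 1 keeps p and this torus in the unit ball. *)
Let expansion_at a (t M' : C) (p : 'rV[C]_d) : 0 < t -> t <= 1 ->
  coef_bound a t M' -> sums_to a t -> sqnorm p < t ^+ 2 ->
  exists b, [/\ forall k, hsum (fun n => a n * (mbin n k)%:R * mpower p (msub n k)) (b k),
    forall w : 'rV[C]_d, (forall j, `|w ord0 j| <= delta) ->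
      hsum (fun k => b k * mpower w k) (F (p + w)) &
    forall k, `|b k| * delta ^+ mdegree k <= M].
Proof.
move=> t0 t1 aM aF pt.
have [s /andP[s0 sd] ps] := sqnorm_thicken delta0 pt.
have t21 : t ^+ 2 <= 1 by rewrite expr_le1 // ltW.
have pos j : 0 <= (absv p + const_mx s) ord0 j by rewrite !mxE addr_ge0 // ltW.
have [M2 HM2] := coef_bound_sum t0 aM pos ps.
have [b hb] := hsum_reexpand_coef s0 HM2.
have [|c hc] := HF (p := p).
  by rewrite /closed_ball_d /= ltW // (lt_le_trans pt).
have bc : b = c.
  apply: (coef_unique s0) => w ws; exists (F (p + w)); split; last first.
    by case: (hc w) => // j; rewrite ws.
  have E : absv p + absv w = absv p + const_mx s.
    by congr (_ + _); apply/rowP => j; rewrite !mxE ws.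
  have [|S [h1 h2]] := hsum_reexpand (w := w) (M := M2) _ hb.
    by move=> K; rewrite E.
  rewrite (hsum_unique (t := F (p + w)) h1) in h2; first exact: h2.
  have lt : sqnorm (p + w) < t ^+ 2.
    apply: le_lt_trans ps; apply: ler_sqnorm => j; rewrite !mxE.
    by rewrite [leRHS]ger0_norm ?addr_ge0 ?(ltW s0) // -(ws j) ler_normD.
  by apply: aF => //; rewrite ltW // (lt_le_trans lt).
exists b; split; first exact: hb.
  by rewrite bc => w /hc[].
move=> k; rewrite bc -mpower_const; apply: (cauchy_coef (f := fun w => F (p + w))).
  by move=> j; rewrite mxE ltW.
by move=> z zd; apply: hc => j; rewrite zd mxE.
Qed.


(* The Taylor coefficients of F at the points of a torus inside the ball of
   radius t are the averages of the re-expanded series; their uniform bound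
   forces the series at 0 to converge beyond t, by a step that does not depend
   on t. *)
Let expansion_step a (t M' : C) : delta <= t -> t <= 1 ->
  coef_bound a t M' -> sums_to a t ->
  coef_bound a (t + delta / 2) (M * (1 - 3 / 4)^-1 ^+ d) /\ sums_to a (t + delta / 2).
Proof.
move=> dt t1 aM aF; have t0 : 0 < t := lt_le_trans delta0 dt.
(* [l] is chosen so that l T = t - delta/4 < t and (1 - l) T = 3 delta/4 < delta: a vector in the
   ball of radius T splits into a centre inside the old ball and a displacement within the uniform
   radius. *)
pose T := t + delta / 2; pose l := (t - delta / 4) / T; pose sg := delta * (3 / 4).
have T0 : 0 < T by rewrite addr_gt0 // divr_gt0.
have T0' : T != 0 by rewrite gt_eqF.
have d4 : 0 < delta / 4 by rewrite divr_gt0.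
have td : 0 < t - delta / 4.
  rewrite subr_gt0; apply: lt_le_trans dt.
  by rewrite gtr_pMr // invf_lt1 // ltr1n.
have l0 : 0 < l by rewrite divr_gt0.
have lT : l * T = t - delta / 4 by rewrite divfK.
have lTt : l * T < t by rewrite lT gtrBl.
have l1T : (1 - l) * T = sg by rewrite mulrBl lT /T /sg; field.
have l1 : l <= 1.
  rewrite ler_pdivrMr // mul1r lerD2l; apply: le_trans (_ : 0 <= _).
    by rewrite oppr_le0 ltW.
  by rewrite divr_ge0 // ltW.
have l1' : 0 <= 1 - l by rewrite subr_ge0.
have sg0 : 0 < sg by rewrite mulr_gt0 // divr_gt0.
have q1 : (3 / 4 : C) < 1 by rewrite ltr_pdivrMr // mul1r ltr_nat.
have q0 : 0 <= (3 / 4 : C) by rewrite divr_ge0.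
have sgd : sg <= delta by rewrite ler_piMr // ltW.
have shrink (z : 'rV[C]_d) : sqnorm z <= T ^+ 2 -> sqnorm (l *: z) < t ^+ 2.
  move=> zT; rewrite sqnormZ (gtr0_norm l0).
  apply: le_lt_trans (_ : (l * T) ^+ 2 < _).
    by rewrite [leRHS]exprMn ler_wpM2l // exprn_ge0 // ltW.
  by rewrite ltrXn2r // ?nnegrE ltW // mulr_gt0.
have bT : coef_bound a T (M * (1 - 3 / 4)^-1 ^+ d).
  move=> rho rho0 rhoT n.
  pose r := l *: rho; have rt : sqnorm r < t ^+ 2 by apply: shrink.
  have r0 j : 0 <= r ord0 j by rewrite mxE mulr_ge0 // ltW.
  (* The re-expanded coefficient at p = r u is, as a function of the torus vector u, essentially a
     power series in u; averaging isolates its n-th term. *)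
  have key k : `|a n| * (mbin n k)%:R * mpower r (msub n k) <= M / delta ^+ mdegree k.
    have -> : `|a n| * (mbin n k)%:R * mpower r (msub n k) =
        `|a n * (mbin n k)%:R * mpower r (msub n k)|.
      by rewrite !normrM normr_nat (ger0_norm (mpower_ge0 _ r0)).
    apply: (coef_average_le (x := fun n => a n * (mbin n k)%:R * mpower r (msub n k))).
    move=> u u1; pose p : 'rV[C]_d := \row_j (r ord0 j * u ord0 j).
    have pt : sqnorm p < t ^+ 2.
      apply: le_lt_trans rt; apply: ler_sqnorm => j; rewrite [in leLHS]mxE normrM u1 mulr1 //.
    have [b [h1 _ h3]] := expansion_at t0 t1 aM aF pt.
    have u1k : `|mpower u k| = 1.
      by rewrite normr_prod big1 // => j _; rewrite normrX u1 expr1n.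
    (* The factor u^k turns p^(m - k) into r^(m - k) u^m. *)
    exists (mpower u k * b k); last first.
      by rewrite normrM u1k mul1r ler_pdivlMr ?exprn_gt0.
    rewrite (_ : (fun m => _) = fun m => mpower u k * (a m * (mbin m k)%:R * mpower p (msub m k))).
      exact: hsumZ (h1 k).
    apply/funext => m; rewrite mpowerM.
    have [km|/mbin_eq0 ->] := boolP (mle k m); last by rewrite !mulr0 !mul0r mulr0.
    rewrite -(mpower_msub u km); ring.
  have [K] := sub_cube [fset n]%fset; rewrite fsub1set => nK.
  have rs j : 0 <= rho ord0 j <= (r + const_mx sg) ord0 j.
    rewrite rho0 !mxE -lerBlDl -[X in X - _]mul1r -mulrBl -l1T ler_wpM2l //.
    rewrite -[leLHS]ger0_norm //; apply: sqnorm_coord_le => //; exact: ltW.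
  apply: le_trans (ler_wpM2l (normr_ge0 _) (ler_mpower n rs)) _.
  rewrite (mpower_binomial _ _ nK) mulr_sumr.
  (* The k-th binomial term is at most M (sg / delta)^|k| = M (3/4)^|k|, and the sum over all k of
     these powers is (1 - 3/4)^-d. *)
  apply: (@le_trans _ _ (\sum_(k <- cube K) M * \prod_j (3 / 4) ^+ k j)).
    apply: ler_sum => k _; rewrite mulrA [X in X * _]mulrA mpower_const.
    apply: le_trans (ler_wpM2r _ (key k)) _; first by rewrite exprn_ge0 // ltW.
    by rewrite -mulrA ler_wpM2l // exprMn mulKf ?expf_neq0 ?gt_eqF // prodrXr.
  rewrite -mulr_sumr ler_wpM2l //; apply: (sum_prod_le (phi := fun i => (3 / 4) ^+ i)).
    by move=> i; rewrite exprn_ge0.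
  by move=> i; apply: sum_geom_le.
split; first exact: bT.
move=> z zT z1; have pt := shrink z (ltW zT).
have [b [h1 h2 _]] := expansion_at t0 t1 aM aF pt.
have absz j : 0 <= absv z ord0 j by rewrite mxE.
have zT' : sqnorm (absv z) < T ^+ 2.
  by apply: le_lt_trans zT; apply: ler_sqnorm => j; rewrite !mxE normr_id.
have [M2 HM2] := coef_bound_sum T0 bT absz zT'.
have E : absv (l *: z) + absv ((1 - l) *: z) = absv z.
  apply/rowP => j; rewrite !mxE (normrM l) (normrM (1 - l)) (gtr0_norm l0) (ger0_norm l1') -mulrDl.
  by rewrite addrC subrK mul1r.
have zE : l *: z + (1 - l) *: z = z by rewrite -scalerDl addrC subrK scale1r.
have [|S [h3 h4]] := hsum_reexpand (p := l *: z) (w := (1 - l) *: z) (M := M2) _ h1.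
  by rewrite E.
rewrite zE in h3; have := h2 ((1 - l) *: z); rewrite zE => h5.
rewrite (hsum_unique (h5 _) h4); first exact: h3.
move=> j; rewrite mxE normrM (ger0_norm l1'); apply: le_trans sgd.
by rewrite -l1T ler_wpM2l // sqnorm_coord_le // ltW.
Qed.

Lemma global_expansion : exists a t M', [/\ 1 < t, coef_bound a t M' & sums_to a t].
Proof.
have B0 : closed_ball_d (0 : 'rV[C]_d).
  rewrite /closed_ball_d /= /sqnorm big1 // => j _.
  by rewrite mxE normr0 expr0n.
have [a Ha] := HF B0; exists a.
(* From radius delta, 2N steps of delta/2 lead to t = 1, the last radius from which a step may
   start; step number 2N + 1 = [N.+1.*2.-1] reaches 1 + delta/2. *)
have H i : (i <= N.+1.*2.-1)%N -> exists M', coef_bound a (delta * (1 + i%:R / 2)) M' /\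
   sums_to a (delta * (1 + i%:R / 2)).
  elim: i => [_|i IH iN].
    rewrite mul0r addr0 mulr1; exists M; split.
      move=> rho rho0 rhod n; apply: le_trans (_ : `|a n| * mpower (const_mx delta) n <= _).
        apply: ler_wpM2l => //; apply: ler_mpower => j.
        rewrite rho0 mxE -[leLHS]ger0_norm // sqnorm_coord_le // ltW //.
      apply: (cauchy_coef (f := fun w => F (0 + w))).
        by move=> j; rewrite mxE ltW.
      by move=> z zd; apply: Ha => j; rewrite zd mxE.
    move=> z zd _; rewrite -[z in F z]add0r; apply: (proj1 (Ha z _)) => j.
    by rewrite sqnorm_coord_le // ltW.
  have [|M' [h1 h2]] := IH; first by apply: ltnW.
  exists (M * (1 - 3 / 4)^-1 ^+ d).
  have -> : delta * (1 + i.+1%:R / 2) = delta * (1 + i%:R / 2) + delta / 2.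
    by rewrite -natr1; field.
  apply: expansion_step h1 h2.
    by rewrite ler_peMr ?(ltW delta0) // lerDl divr_ge0.
  rewrite mulrC ler_pdivrMr // mul1r -lerBrDl -[N.+1%:R]natr1 addrK ler_pdivrMr //.
  rewrite -natrM ler_nat muln2; move: iN; rewrite doubleS /=; lia.
have [M' [h1 h2]] := H _ (leqnn _).
exists (delta * (1 + (N.+1.*2.-1)%:R / 2)), M'; split => //.
rewrite mulrC ltr_pdivlMr // mul1r doubleS /= -[N.*2.+1%:R]natr1 -muln2 natrM -[N.+1%:R]natr1.
rewrite -subr_gt0 (_ : _ - _ = 2^-1); last by field.
by rewrite invr_gt0.
Qed.

End GlobalExpansion.

(** * Functions analytic on the closed ball belong to the Drury-Arveson space *)

Section HolomorphicInDA.
Context {R : realType}.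
Local Notation C := (Cplx R).

Lemma pow_le_fact_expR (x : R) N : 0 <= x -> x ^+ N <= N`!%:R * expR x.
Proof.
move=> x0; case: N => [|N]; first by rewrite expr0 fact0 mul1r -expR0 ler_expR.
rewrite [leRHS]mulrC -ler_pdivrMr ?ltr0n ?fact_gt0 //.
by apply: (le_trans _ (expR_ge1Dxn N x0)); rewrite lerDr.
Qed.

(** A crude Stirling bound; the induction step is (1 - 1/n)^n <= 1/e with n = k + 2. *)
Lemma fact_expR_le k : k`!%:R * expR k%:R <= k.+1%:R ^+ k.+1 :> R.
Proof.
elim: k => [|k IH]; first by rewrite fact0 expR0 mulr1 expr1.
pose n := k.+2; pose y : R := n%:R; have y0 : 0 < y by rewrite ltr0n.
have step : y - 1 <= y * expR (- y^-1).
  have := expR_ge1Dx (- y^-1); rewrite -(ler_pM2l y0) => h; apply: (le_trans _ h).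
  by rewrite mulrDr mulr1 mulrN divff // gt_eqF.
have y1 : y - 1 = k.+1%:R by rewrite /y /n -[k.+2%:R]natr1 addrK.
have : (y - 1) ^+ n <= y ^+ n * expR (-1).
  have -> : expR (-1) = expR (- y^-1) ^+ n.
    by rewrite -expRM_natl mulrN divff // gt_eqF.
  rewrite -exprMn lerXn2r // nnegrE; first by rewrite y1.
  by rewrite mulr_ge0 ?expR_ge0 // ltW.
rewrite y1 expRN ler_pdivlMr ?expR_gt0 // => h.
apply: (le_trans _ h); rewrite factS natrM -[in expR _]natr1 expRD exprS.
by rewrite mulrA ler_wpM2r ?expR_ge0 // -mulrA ler_wpM2l.
Qed.

Context {d : nat}.
Implicit Types (n k m : mindex d) (K : {fset mindex d}) (a b c : mindex d -> C).

(** The factor e^N gained from the factorials of the n_j cancels the one lost in (N + d)^N <= N!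
    e^(N + d), where N = |n|. The result is an upper bound for 1 / beta(n), and N + d, the sum of
    the n_j + 1, will normalize the polyradius. *)
Lemma multinomial_bound n :
  (mfactorial n)%:R * (mdegree n + d)%:R ^+ mdegree n <=
  (expR d%:R)%:C%C * (mdegree n)`!%:R * \prod_j (n j).+1%:R ^+ (n j).+1 :> C.
Proof.
set N := mdegree n.
have key : (mfactorial n)%:R * (N + d)%:R ^+ N <=
  expR d%:R * N`!%:R * \prod_j (n j).+1%:R ^+ (n j).+1 :> R.
  rewrite -(ler_pM2r (expR_gt0 N%:R)).
  have h1 : (mfactorial n)%:R * expR N%:R <= \prod_j (n j).+1%:R ^+ (n j).+1 :> R.
    rewrite /mfactorial /N /mdegree natr_prod natr_sum expR_sum -big_split /=.
    by apply: ler_prod => j _; rewrite mulr_ge0 ?expR_ge0 //= fact_expR_le.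
  have h2 : (N + d)%:R ^+ N <= N`!%:R * (expR N%:R * expR d%:R) :> R.
    by rewrite -expRD -natrD pow_le_fact_expR.
  rewrite mulrAC; apply: le_trans (ler_pM _ _ h1 h2) _; rewrite ?mulr_ge0 ?expR_ge0 ?exprn_ge0 //.
  by rewrite le_eqVlt; apply/orP; left; apply/eqP; ring.
have := key; rewrite -lecR !rmorphM !rmorph_nat rmorphXn rmorph_prod /= rmorph_nat.
move/le_trans; apply; rewrite le_eqVlt; apply/orP; left; apply/eqP; congr (_ * _).
by rewrite rmorph_prod; apply: eq_bigr => j _; rewrite /= rmorphXn rmorph_nat.
Qed.

(* Cauchy's inequality is applied with rho_j^2 proportional to n_j + 1: up to
   that shift, which avoids 0^0, this maximizes rho^n on the sphere, and the
   maximum is t^|n| / sqrt (beta n) up to polynomial factors. *)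
Lemma coef_bound_isummable a (t M : C) : (0 < d)%N -> 1 < t -> coef_bound a t M ->
  isummable (fun n => `|a n| ^+ 2 / mbeta n).
Proof.
move=> d0 t1 aM; have t0 : 0 < t := lt_trans ltr01 t1.
pose E : C := (expR (d%:R : R))%:C%C; have E0 : 0 <= E by rewrite ler0c expR_ge0.
pose q : C := t ^- 2.
have q0 : 0 <= q by rewrite invr_ge0 exprn_ge0 // ltW.
have q1 : q < 1 by rewrite invf_lt1 ?exprn_gt0 // exprn_egt1.
(* [i.+1] is the polynomial loss caused by the shift, [q ^+ i] the gain from t > 1. *)
pose phi i : C := i.+1%:R * q ^+ i.
suff key n : `|a n| ^+ 2 / mbeta n <= M ^+ 2 * E * \prod_j phi (n j).
  have [||s hs] := @nonneg_hsum R _ (fun n => `|a n| ^+ 2 / mbeta n)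
    (M ^+ 2 * E * (1 - q)^-1 ^+ 2 ^+ d).
  - by move=> n; rewrite divr_ge0 ?exprn_ge0 // divr_ge0.
  - move=> K; apply: le_trans (ler_sum _ (fun n _ => key n)) _.
    rewrite -mulr_sumr ler_wpM2l //.
      apply: mulr_ge0 => //; rewrite exprn_ge0 //.
      apply: le_trans (aM 0 _ _ 0); rewrite ?mulr_ge0 ?mpower_ge0 //.
      + by move=> j; rewrite mxE.
      + by move=> j; rewrite mxE.
      + by rewrite /sqnorm big1 ?exprn_ge0 ?(ltW t0) // => j _; rewrite mxE normr0 expr0n.
    apply: sum_prod_le => [i|N]; first by rewrite mulr_ge0 ?exprn_ge0.
    exact: sum_geom2_le.
  by exists s.
set N := mdegree n.
have Nd0 : 0 < (N + d)%:R :> C by rewrite ltr0n addn_gt0 d0 orbT.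
pose rho : 'rV[C]_d := \row_j (t * sqrtC ((n j).+1%:R / (N + d)%:R)).
have s0 j : 0 <= (n j).+1%:R / (N + d)%:R :> C by rewrite divr_ge0.
have rho0 j : 0 <= rho ord0 j by rewrite mxE mulr_ge0 ?sqrtC_ge0 // ltW.
have rhot : sqnorm rho <= t ^+ 2.
  rewrite /sqnorm (eq_bigr (fun j => t ^+ 2 / (N + d)%:R * (n j).+1%:R)).
    rewrite -mulr_sumr -natr_sum (_ : (\sum_j (n j).+1)%N = (N + d)%N) ?divfK ?gt_eqF //.
    rewrite /N /mdegree; under eq_bigr do rewrite -addn1.
    by rewrite big_split /= sum_nat_const card_ord muln1.
  move=> j _; rewrite ger0_norm // mxE exprMn sqrtCK; ring.
have := aM rho rho0 rhot n => h.
have rhoE : mpower rho n ^+ 2 =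
    (t ^+ 2) ^+ N * (\prod_j (n j).+1%:R ^+ n j / (N + d)%:R ^+ N).
  rewrite /mpower -prodrXl (eq_bigr (fun j =>
    (t ^+ 2) ^+ n j * ((n j).+1%:R ^+ n j * ((N + d)%:R^-1) ^+ n j))).
    by rewrite !big_split /= !prodrXr exprVn.
  move=> j _; rewrite mxE [LHS]exprAC [X in X ^+ _ = _]exprMn sqrtCK [LHS]exprMn.
  by congr (_ * _); rewrite exprMn.
have h2 : `|a n| ^+ 2 * ((t ^+ 2) ^+ N * (\prod_j (n j).+1%:R ^+ n j / (N + d)%:R ^+ N)) <= M ^+ 2.
  rewrite -rhoE -exprMn lerXn2r ?nnegrE ?mulr_ge0 ?mpower_ge0 //.
  by apply: (le_trans _ h); rewrite mulr_ge0 ?mpower_ge0.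
have f0 : 0 < N`!%:R :> C by rewrite ltr0n fact_gt0.
have mf0 : 0 < (mfactorial n)%:R :> C by rewrite ltr0n prodn_gt0 // => j; rewrite fact_gt0.
have := multinomial_bound n; rewrite -/N -/E => h3.
have t2N : 0 < (t ^+ 2) ^+ N by rewrite !exprn_gt0.
have phiE : \prod_j phi (n j) = \prod_j (n j).+1%:R / (t ^+ 2) ^+ N.
  by rewrite big_split /= prodrXr exprVn.
have betaE : (mbeta n)^-1 = (mfactorial n)%:R / N`!%:R :> C by rewrite /mbeta invf_div.
rewrite betaE phiE.
have P0 : 0 < \prod_j (n j).+1%:R :> C by apply: prodr_gt0 => j _; rewrite ltr0n.
have Nd : 0 < (N + d)%:R ^+ N :> C by rewrite exprn_gt0.
have h4 : (mfactorial n)%:R / N`!%:R <= E * (\prod_j (n j).+1%:R ^+ (n j).+1) / (N + d)%:R ^+ N.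
  rewrite ler_pdivrMr // mulrAC ler_pdivlMr //; apply: le_trans h3 _.
  by rewrite mulrAC.
apply: le_trans (ler_wpM2l (exprn_ge0 2 (normr_ge0 _)) h4) _.
have -> : \prod_j (n j).+1%:R ^+ (n j).+1 = \prod_j (n j).+1%:R * \prod_j (n j).+1%:R ^+ n j :> C.
  by rewrite -big_split /=; apply: eq_bigr => j _; rewrite exprS.
set P := \prod_j (n j).+1%:R in P0 *; set Q := \prod_j _ ^+ n j in h2 *.
have -> : `|a n| ^+ 2 * (E * (P * Q) / (N + d)%:R ^+ N) =
    (`|a n| ^+ 2 * ((t ^+ 2) ^+ N * (Q / (N + d)%:R ^+ N))) * (E * (P / (t ^+ 2) ^+ N)).
  by field; rewrite !gt_eqF.
rewrite -[leRHS]mulrA ler_wpM2r // mulr_ge0 // divr_ge0 // ltW //.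
Qed.

Lemma Hol_closed_ball_expansion (f : Bd R d -> C) : Hol_closed_ball f ->
  exists a t M, [/\ 1 < t, coef_bound a t M & has_power_series f a].
Proof.
move=> [U [F [Uo BU hF fF]]].
have [N HN] := uniform_expansion Uo BU hF.
have [a [t [M [t1 aM aF]]]] := global_expansion HN.
exists a, t, M; split=> //.
move=> z; rewrite fF; apply: aF; last by rewrite ltW // (valP z).
by apply: lt_trans (valP z) _; rewrite exprn_egt1.
Qed.

Lemma Hol_closed_ball_DA : (0 < d)%N -> @Hol_closed_ball R d `<=` DA R d.
Proof.
move=> d0 f /Hol_closed_ball_expansion[a [t [M [t1 aM fa]]]].
by exists a => //; exact: coef_bound_isummable d0 t1 aM.
Qed.

End HolomorphicInDA.

(** * Taylor coefficients, norms and products of power series on the ball *)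

Section PowerSeries.
Context {R : realType}.
Local Notation C := (Cplx R).

(** By the reverse triangle inequality the finite sums also converge to |s|; this makes s real and
    nonnegative at once. *)
Lemma nonneg_hsum_norm (I : choiceType) (x : I -> C) s :
  (forall i, 0 <= x i) -> hsum x s -> s = `|s|.
Proof.
move=> x0 xs; apply: (hsum_unique xs); apply/hsumP => e e0.
have /hsumP/(_ e e0)[J HJ] := xs; exists J => K JK.
apply: le_lt_trans (HJ K JK).
rewrite -[\sum_(i <- K) x i in leLHS]ger0_norm ?sumr_ge0 //; exact: ler_dist_dist.
Qed.

Lemma nonneg_hsum_ge (I : choiceType) (x : I -> C) s (K : {fset I}) :
  (forall i, 0 <= x i) -> hsum x s -> \sum_(i <- K) x i <= s.
Proof.
move=> x0 xs; rewrite (nonneg_hsum_norm x0 xs); apply/ler_addgt0Pr => e e0.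
have /hsumP/(_ e e0)[J HJ] := xs.
have := HJ _ (fsubsetUl J K); set S := \sum_(i <- _) _ => h.
apply: (@le_trans _ _ S); first by apply: ler_sum_fset => //; exact: fsubsetUr.
have S0 : 0 <= S by apply: sumr_ge0.
rewrite -[leLHS]ger0_norm // -[S](subrK s) addrC.
by apply: le_trans (ler_normD _ _) _; rewrite lerD2l ltW.
Qed.

Lemma isummable_le d (x y : mindex d -> C) : (forall n, 0 <= x n <= y n) ->
  isummable y -> isummable x.
Proof.
move=> xy [s ys]; have y0 n : 0 <= y n by have /andP[/le_trans h /h] := xy n.
apply: (nonneg_hsum (M := s)) => [n|K]; first by have /andP[] := xy n.
apply: le_trans (nonneg_hsum_ge K y0 ys); apply: ler_sum => n _.
by have /andP[] := xy n.
Qed.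

Context {d : nat}.
Implicit Types (n k m : mindex d) (K J : {fset mindex d}) (a b c : mindex d -> C).
Implicit Types (f g : Bd R d -> C).

Lemma has_power_series_unique f a b :
  has_power_series f a -> has_power_series f b -> a = b.
Proof.
(* The torus of radius 1 / (d + 1) lies in the ball, as d < (d + 1)^2. *)
move=> fa fb; have s0 : 0 < (d.+1)%:R^-1 :> C by rewrite invr_gt0.
apply: (coef_unique s0) => z zs.
have z1 : sqnorm z < 1.
  rewrite /sqnorm (eq_bigr (fun=> (d.+1)%:R^-1 ^+ 2)) => [|j _]; last by rewrite zs.
  rewrite sumr_const card_ord -[_ *+ d]mulr_natr exprVn mulrC ltr_pdivrMr ?exprn_gt0 //.
  rewrite mul1r -natrX ltr_nat; nia.
by exists (f (exist _ z z1)); split; [exact: (fa (exist _ z z1))|exact: (fb (exist _ z z1))].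
Qed.

Lemma taylor_eq f a : has_power_series f a -> taylor f = a.
Proof.
move=> fa; apply: (@has_power_series_unique f _ _ _ fa).
by apply: (@xgetPex _ (fun=> 0) [set a | has_power_series f a]); exists a.
Qed.

Lemma DA_power_series f : DA R d f -> has_power_series f (taylor f).
Proof. by case=> a fa _; rewrite (taylor_eq fa). Qed.

Lemma DA_isummable f : DA R d f -> isummable (fun n => `|taylor f n| ^+ 2 / mbeta n).
Proof. by case=> a fa; rewrite (taylor_eq fa). Qed.

Lemma mbeta_gt0 n : 0 < mbeta n :> C.
Proof. by rewrite divr_gt0 // ltr0n ?fact_gt0 // prodn_gt0 // => j; rewrite fact_gt0. Qed.

Lemma DA_norm_sqr f : DA R d f ->
  hsum (fun n => `|taylor f n| ^+ 2 / mbeta n) (DA_norm f ^+ 2).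
Proof. by case/DA_isummable => s hs; rewrite /DA_norm sqrtCK (isum_eq hs). Qed.

Let term_ge0 a n : 0 <= `|a n| ^+ 2 / mbeta n.
Proof. by rewrite divr_ge0 ?exprn_ge0 // ltW // mbeta_gt0. Qed.

Lemma DA_norm_ge0 f : DA R d f -> 0 <= DA_norm f.
Proof.
case/DA_isummable => s hs; rewrite /DA_norm sqrtC_ge0 (isum_eq hs).
rewrite (nonneg_hsum_norm _ hs) // => n; exact: term_ge0.
Qed.

(** A single term of the series for the squared norm: coefficient functionals are bounded on
    [H_d]. *)
Lemma taylor_norm_le f n : DA R d f -> `|taylor f n| <= sqrtC (mbeta n) * DA_norm f.
Proof.
move=> hf; have b0 := mbeta_gt0 n; have D0 := DA_norm_ge0 hf.
rewrite -(ler_pXn2r (n := 2)) ?nnegrE ?mulr_ge0 ?D0 ?sqrtC_ge0 ?(ltW b0) //.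
rewrite exprMn sqrtCK mulrC -ler_pdivrMr //.
have := nonneg_hsum_ge [fset n]%fset (fun n => term_ge0 _ n) (DA_norm_sqr hf).
by rewrite big_seq_fset1.
Qed.

(** A slightly dilated point [l^-1 *: val z] is still in the ball; the terms there are bounded, and
    Abel's lemma applies at z. *)
Lemma power_series_abs f a (z : Bd R d) : has_power_series f a ->
  exists M, forall K, \sum_(n <- K) `|a n| * mpower (absv (val z)) n <= M.
Proof.
move=> fa; set x := sqnorm (val z).
have x0 : 0 <= x := sqnorm_ge0 _; have x1 : x < 1 := valP z.
pose l := (1 + x) / 2; have l0 : 0 < l by rewrite divr_gt0 // ltr_pwDl.
have l1 : l < 1 by rewrite ltr_pdivrMr // mul1r -[ltRHS]/(1 + 1) ltrD2l.
have xl : x < l ^+ 2.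
  rewrite -subr_gt0 (_ : _ - _ = ((1 - x) / 2) ^+ 2); last by rewrite /l; field.
  by rewrite exprn_gt0 // divr_gt0 // subr_gt0.
have z1 : sqnorm (l^-1 *: val z) < 1.
  rewrite sqnormZ normfV (gtr0_norm l0) exprVn mulrC ltr_pdivrMr ?exprn_gt0 //.
  by rewrite mul1r.
have [M HM] := hsum_bounded (fa (exist _ (l^-1 *: val z) z1)).
exists (M * (1 - l)^-1 ^+ d).
apply: (abs_bound_geom (rho := absv (l^-1 *: val z)) (ltW l0) l1).
  by move=> n; have := HM n; rewrite normrM -mpower_absv.
by move=> j; rewrite !mxE normr_ge0 normrM normfV (gtr0_norm l0) mulVKf ?gt_eqF //= lexx.
Qed.

Definition cauchy_product a b m : C :=
  \sum_(n <- cube (mdegree m).+1) if mle n m then a n * b (msub m n) else 0.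

Lemma mle_cube n m : mle n m -> n \in cube (mdegree m).+1.
Proof.
move/forallP => nm; rewrite in_cube; apply/forallP => j; rewrite ltnS.
by apply: leq_trans (nm j) _; rewrite /mdegree (bigD1 j) //= leq_addr.
Qed.

Lemma hsum_shift (x : mindex d -> C) s n : hsum x s ->
  hsum (fun m => if mle n m then x (msub m n) else 0) s.
Proof.
move=> xs; pose h k : mindex d := [ffun j => (n j + k j)%N].
have hK k : msub (h k) n = k by apply/ffunP => j; rewrite !ffunE addKn.
have nh k : mle n (h k) by apply/forallP => j; rewrite ffunE leq_addr.
apply: (@hsum_reindex _ _ _ h (fun m => msub m n)); first exact: hK.
  move=> m hm; case: ifP => // /forallP nm; case: hm; apply/ffunP => j.
  by rewrite !ffunE subnKC.
by rewrite (_ : _ \o h = x) //; apply/funext => k /=; rewrite nh hK.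
Qed.

Lemma sum_shift_le (x : mindex d -> C) n K M : (forall k, 0 <= x k) ->
  (forall K, \sum_(k <- K) x k <= M) ->
  \sum_(m <- K) (if mle n m then x (msub m n) else 0) <= M.
Proof.
move=> x0 xM; pose L := [fset m in K | mle n m]%fset.
apply: le_trans (xM [fset msub m n | m in L]%fset).
rewrite -big_mkcond big_fset_condE -/L [leRHS]big_imfset //= => m m' /=.
rewrite !inE => /andP[_ /forallP nm] /andP[_ /forallP nm'].
move/ffunP => E; apply/ffunP => j; have := E j; rewrite !ffunE => Ej.
by rewrite -(subnK (nm j)) Ej subnK.
Qed.

(** Fubini for the family a(n) b(m - n) z^m, zero unless n <= m: rows sum to a(n) z^n g(z), columns
    to the terms of the Cauchy product. *)
Lemma has_power_seriesM f g a b : has_power_series f a -> has_power_series g b ->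
  has_power_series (fun z => f z * g z) (cauchy_product a b).
Proof.
move=> fa gb z; pose w := val z.
have [Ma HMa] := power_series_abs z fa; have [Mb HMb] := power_series_abs z gb.
pose y k : C := b k * mpower w k.
pose x n m : C := a n * mpower w n * (if mle n m then y (msub m n) else 0).
have [|||S [h1 h2]] := @hsum_fubini _ _ _ x (Ma * Mb) _ (fun n => a n * mpower w n * g z)
    (fun m => cauchy_product a b m * mpower w m).
- move=> A B; apply: (@le_trans _ _ (\sum_(n <- A) (`|a n| * mpower (absv w) n) * Mb)).
    apply: ler_sum => n _.
    under eq_bigr do rewrite normrM.
    rewrite -mulr_sumr normrM -mpower_absv ler_wpM2l //.
      by rewrite mulr_ge0 // mpower_ge0 // => j; rewrite mxE.
    rewrite (eq_bigr (fun m => if mle n m then `|y (msub m n)| else 0)); last first.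
      by move=> m _; case: ifP; rewrite ?normr0.
    apply: (sum_shift_le (x := fun k => `|y k|)) => // L.
    by apply: le_trans (HMb L); apply: ler_sum => k _; rewrite normrM mpower_absv.
  rewrite -mulr_suml ler_wpM2r //.
  by apply: le_trans (HMb fset0); rewrite big_nil.
- by move=> n; apply: hsumZ; apply: hsum_shift; exact: gb.
- move=> m; rewrite /cauchy_product mulr_suml.
  rewrite (eq_bigr (fun n => x n m)); first apply: hsum_fin => n nm.
    by rewrite /x ifN ?mulr0 //; apply: contra nm; exact: mle_cube.
  move=> n _; rewrite /x /y; case: ifP => nm; last by rewrite mulr0 mul0r.
  by rewrite -(mpower_msub w nm); ring.
suff <- : S = f z * g z by exact: h2.
apply: (hsum_unique h1).
rewrite mulrC (_ : (fun n => _) = fun n => g z * (a n * mpower w n)).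
  by apply: hsumZ; exact: fa.
by apply/funext => n; rewrite mulrC.
Qed.

Lemma has_power_series_lin f g a b (c : C) : has_power_series f a -> has_power_series g b ->
  has_power_series (fun z => c * f z + g z) (fun n => c * a n + b n).
Proof.
move=> fa gb z.
rewrite (_ : (fun n => _) = fun n => c * (a n * mpower (val z) n) + b n * mpower (val z) n).
  by apply: hsumD; [apply: hsumZ; exact: fa|exact: gb].
by apply/funext => n; rewrite mulrDl mulrA.
Qed.

Definition mpoly a J (z : 'rV[C]_d) : C := \sum_(n <- J) a n * mpower z n.

Definition restrict a J n : C := if n \in J then a n else 0.

Lemma mpoly_power_series a J :
  has_power_series (fun z : Bd R d => mpoly a J (val z)) (restrict a J).
Proof.
move=> z; rewrite /mpoly (eq_fbigr _ _ (G := fun n => restrict a J n * mpower (val z) n)).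
  by apply: hsum_fin => n /negbTE nJ; rewrite /restrict nJ mul0r.
by move=> n nJ _; rewrite /restrict nJ.
Qed.

Lemma mpoly_DA a J : DA R d (fun z : Bd R d => mpoly a J (val z)).
Proof.
exists (restrict a J); first exact: mpoly_power_series.
exists (\sum_(n <- J) `|restrict a J n| ^+ 2 / mbeta n); apply: hsum_fin => n nJ.
by rewrite /restrict (negbTE nJ) normr0 expr0n mul0r.
Qed.

Lemma mpoly_Hol a J : Hol_closed_ball (fun z : Bd R d => mpoly a J (val z)).
Proof.
exists setT, (mpoly a J); split => //; first exact: openT.
move=> p _; exists (fun k => \sum_(n <- J) a n * ((mbin n k)%:R * mpower p (msub n k))).
apply/nbhs_ballP; exists 1 => //= z _; have E : p + (z - p) = z by rewrite addrC subrK.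
rewrite -[z in mpoly _ _ z]E (_ : (fun k => _) = fun k =>
    \sum_(n <- J) a n * ((mbin n k)%:R * mpower p (msub n k) * mpower (z - p) k)).
  by apply: hsum_sum => n; apply: hsumZ; apply: hsum_binomial.
by apply/funext => k; rewrite mulr_suml; apply: eq_bigr => n _; rewrite -mulrA.
Qed.

Lemma zmonomialE m : zmonomial R m = fun z : Bd R d => mpoly (fun=> 1) [fset m]%fset (val z).
Proof. by apply/funext => z; rewrite /mpoly big_seq_fset1 mul1r. Qed.

Lemma taylor_zmonomial m n : taylor (zmonomial R m) n = (n == m)%:R.
Proof.
rewrite zmonomialE (taylor_eq (@mpoly_power_series (fun=> 1) [fset m]%fset)) /restrict inE.
by case: eqP.
Qed.

End PowerSeries.

#[local] Opaque Cplx mbeta DA_norm.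

(** * Existence, uniqueness and kernel of the Hankel operator of a monomial *)

Section Hankel.
Context {R : realType} {d : nat}.
Local Notation C := (Cplx R).
Implicit Types (n k m : mindex d) (K J : {fset mindex d}) (a b c : mindex d -> C).
Implicit Types (f g h : Bd R d -> C).

Lemma ler_normMl (x y M : C) : 0 <= x -> 0 <= y -> x <= M * y -> x <= `|M| * y.
Proof.
move=> x0 y0 h; apply: (le_trans h).
by rewrite -[leLHS](ger0_norm (le_trans x0 h)) normrM (ger0_norm y0).
Qed.

Lemma eq_ler (x y : C) : x = y -> x <= y.
Proof. by move=> ->. Qed.

Lemma ler_sqrtCM (x y M : C) : 0 <= x -> 0 <= y -> 0 <= M ->
  x ^+ 2 <= M * y ^+ 2 -> x <= sqrtC M * y.
Proof.
move=> x0 y0 M0 h; rewrite -(ler_pXn2r (n := 2)) ?nnegrE ?mulr_ge0 ?sqrtC_ge0 //.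
by rewrite [leRHS]exprMn sqrtCK.
Qed.

Lemma conjfK : involutive (@conjf R d).
Proof. by move=> f; apply/funext => z; rewrite /conjf conjCK. Qed.

Lemma DAbar_DA f : DAbar f -> DA R d (conjf f).
Proof. by case=> h hh <-; rewrite conjfK. Qed.

Lemma taylorM f g : DA R d f -> DA R d g ->
  taylor (fun z => f z * g z) = cauchy_product (taylor f) (taylor g).
Proof.
move=> hf hg; apply: taylor_eq.
by apply: has_power_seriesM; apply: DA_power_series.
Qed.

Lemma taylor_lin f g (c : C) : DA R d f -> DA R d g ->
  taylor (fun z => c * f z + g z) = fun n => c * taylor f n + taylor g n.
Proof.
move=> hf hg; apply: taylor_eq.
by apply: has_power_series_lin; apply: DA_power_series.
Qed.

Lemma DA_inner_zmonomial h m : DA_inner h (zmonomial R m) = taylor h m / mbeta m.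
Proof.
rewrite /DA_inner (_ : _ / _ = taylor h m * (taylor (zmonomial R m) m)^* / mbeta m); last first.
  by rewrite taylor_zmonomial eqxx conjC1 mulr1.
apply: isum_eq; apply: (@hsum1 _ _ m) => n /negbTE nm.
by rewrite taylor_zmonomial nm conjC0 mulr0 mul0r.
Qed.

(** Obtained by testing the Hankel identity with g = z^k: the conjugate of the k-th coefficient over
    beta(k) must equal <f z^k, z^m>, which is f^(m - k) / beta(m) for k <= m and 0 otherwise. *)
Definition hankel_coef m f k : C :=
  if mle k m then (taylor f (msub m k))^* * mbeta k / mbeta m else 0.

Let box_fset m : {fset mindex d} := cube (mdegree m).+1.

Lemma msubK m n : mle n m -> msub m (msub m n) = n.
Proof. by move/forallP => nm; apply/ffunP => j; rewrite !ffunE subKn. Qed.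

Lemma mle_msub m n : mle (msub m n) m.
Proof. by apply/forallP => j; rewrite ffunE leq_subr. Qed.

Lemma hankel_coef_box m f k : k \notin box_fset m -> hankel_coef m f k = 0.
Proof. by move=> kJ; rewrite /hankel_coef ifN //; apply: contra kJ; exact: mle_cube. Qed.

Lemma conj_mbeta k : (mbeta k)^* = mbeta k :> C.
Proof. by apply: conj_Creal; apply: gtr0_real; exact: mbeta_gt0. Qed.

Lemma conj_mul_mbeta (x : C) k m : (x * mbeta k / mbeta m)^* = x^* * mbeta k / mbeta m.
Proof. by rewrite rmorphM fmorphV rmorphM /= !conj_mbeta. Qed.

Lemma normrM_mbeta (x : C) k : `|x * mbeta k| = `|x| * mbeta k.
Proof. by rewrite normrM [X in _ * X]gtr0_norm // mbeta_gt0. Qed.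

Lemma normr_div_mbeta (x : C) k : `|x / mbeta k| = `|x| / mbeta k.
Proof. by rewrite normrM [X in _ * X]gtr0_norm // invr_gt0 mbeta_gt0. Qed.

(** This continuity in f lets the density argument pass to the limit; summed over the finitely many
    k it also gives the symbol bound and the operator bound. *)
Lemma hankel_coef_le m k : exists2 B : C, 0 <= B &
  forall f, DA R d f -> `|hankel_coef m f k| <= B * DA_norm f.
Proof.
exists (sqrtC (mbeta (msub m k)) * mbeta k / mbeta m).
  by rewrite divr_ge0 ?mulr_ge0 ?sqrtC_ge0 // ltW // mbeta_gt0.
move=> f hf; have bm := @mbeta_gt0 R d m; have bk := @mbeta_gt0 R d k.
rewrite /hankel_coef; case: ifP => _; last first.
  rewrite normr0 mulr_ge0 ?DA_norm_ge0 // divr_ge0 ?mulr_ge0 ?sqrtC_ge0 // ltW // mbeta_gt0 //.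
rewrite normr_div_mbeta normrM_mbeta norm_conjC [leRHS]mulrAC ler_wpM2r ?invr_ge0 ?(ltW bm) //.
by rewrite [leRHS]mulrAC ler_wpM2r ?(ltW bk) // taylor_norm_le.
Qed.

Definition hankel_op m f : Bd R d -> C :=
  conjf (fun z => mpoly (hankel_coef m f) (box_fset m) (val z)).

Lemma taylor_hankel_op m f : taylor (conjf (hankel_op m f)) = hankel_coef m f.
Proof.
rewrite conjfK (taylor_eq (@mpoly_power_series R d (hankel_coef m f) (box_fset m))).
apply/funext => k; rewrite /restrict; case: ifPn => // kJ.
by rewrite hankel_coef_box.
Qed.

Lemma DA_inner_mul_zmonomial m f g : DA R d f -> DA R d g ->
  DA_inner (fun z => f z * g z) (zmonomial R m) =
  \sum_(k <- box_fset m) taylor g k * (hankel_coef m f k)^* / mbeta k.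
Proof.
move=> hf hg; rewrite DA_inner_zmonomial.
rewrite (_ : (fun z => _) = fun z => g z * f z); last first.
  by apply/funext => z; rewrite mulrC.
rewrite taylorM // /cauchy_product mulr_suml; apply: eq_bigr => k _.
rewrite /hankel_coef; case: ifP => _; last by rewrite conjC0 mulr0 !mul0r.
rewrite conj_mul_mbeta conjCK.
have b0 : mbeta k != 0 :> C by rewrite gt_eqF // mbeta_gt0.
have b1 : mbeta m != 0 :> C by rewrite gt_eqF // mbeta_gt0.
by field; rewrite b0 b1.
Qed.

Lemma is_symbol_zmonomial m : (0 < d)%N -> is_symbol (zmonomial R m).
Proof.
move=> d0; split; first by rewrite zmonomialE; apply: mpoly_DA.
have /choice[B HB] : forall k, exists B : C, 0 <= B /\
    forall f, DA R d f -> `|hankel_coef m f k| <= B * DA_norm f.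
  by move=> k; have [B h1 h2] := hankel_coef_le m k; exists B.
pose M : C := \sum_(k <- box_fset m) sqrtC (mbeta k) * B k / mbeta k.
have M0 : 0 <= M.
  apply: sumr_ge0 => k _; have [Bk _] := HB k.
  by rewrite divr_ge0 ?mulr_ge0 ?sqrtC_ge0 // ltW // mbeta_gt0.
exists (M + 1); first by rewrite ltr_wpDl.
move=> f g /(Hol_closed_ball_DA d0) hf /(Hol_closed_ball_DA d0) hg.
rewrite DA_inner_mul_zmonomial //.
have f0 := DA_norm_ge0 hf; have g0 := DA_norm_ge0 hg.
apply: (@le_trans _ _ (M * DA_norm f * DA_norm g)); last first.
  by apply: ler_wpM2r; [exact: g0|apply: ler_wpM2r; [exact: f0|rewrite lerDl ler01]].
rewrite -mulrA mulr_suml; apply: le_trans (ler_norm_sum _ _ _) _.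
apply: ler_sum => k _; have [Bk /(_ f hf) Hf] := HB k.
have bk := @mbeta_gt0 R d k.
rewrite normr_div_mbeta normrM norm_conjC [leRHS]mulrAC ler_wpM2r ?invr_ge0 ?(ltW bk) //.
apply: le_trans (ler_pM (normr_ge0 _) (normr_ge0 _) (taylor_norm_le k hg) Hf) _.
by rewrite mulrACA [X in _ <= _ * X]mulrC lexx.
Qed.

Lemma is_hankel_hankel_op m : (0 < d)%N -> is_hankel (zmonomial R m) (hankel_op m).
Proof.
move=> d0; split; first exact: is_symbol_zmonomial.
- move=> f hf; exists (conjf (hankel_op m f)); last by rewrite conjfK.
  by rewrite conjfK; apply: mpoly_DA.
- move=> c f g hf hg; apply/funext => z.
  rewrite /hankel_op /conjf -[c in RHS]conjCK -rmorphM -rmorphD; congr (_^*).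
  rewrite /mpoly mulr_sumr -big_split /=; apply: eq_bigr => k _.
  rewrite mulrA -mulrDl; congr (_ * _); rewrite /hankel_coef taylor_lin //.
  case: ifP => _; last by rewrite mulr0 addr0.
  by rewrite rmorphD rmorphM /= !mulrDl !mulrA.
- have /choice[B HB] : forall k, exists B : C, 0 <= B /\
      forall f, DA R d f -> `|hankel_coef m f k| <= B * DA_norm f.
    by move=> k; have [B h1 h2] := hankel_coef_le m k; exists B.
  pose M : C := \sum_(k <- box_fset m) B k ^+ 2 / mbeta k.
  have M0 : 0 <= M.
    apply: sumr_ge0 => k _; have [Bk _] := HB k.
    by rewrite divr_ge0 ?exprn_ge0 // ltW // mbeta_gt0.
  exists (sqrtC M) => f hf; have f0 := DA_norm_ge0 hf.
  have hT : DA R d (conjf (hankel_op m f)) by rewrite conjfK; apply: mpoly_DA.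
  have T0 := DA_norm_ge0 hT.
  apply: ler_sqrtCM; [exact: T0|exact: f0|exact: M0|rewrite /DAbar_norm].
  have := DA_norm_sqr hT; rewrite taylor_hankel_op => h.
  have h' : hsum (fun k => `|hankel_coef m f k| ^+ 2 / mbeta k)
      (\sum_(k <- box_fset m) `|hankel_coef m f k| ^+ 2 / mbeta k).
    by apply: hsum_fin => k kJ; rewrite hankel_coef_box // normr0 expr0n mul0r.
  apply: le_trans (eq_ler (hsum_unique h h')) _.
  rewrite [leRHS]mulr_suml.
  apply: ler_sum => k _.
  have [Bk /(_ f hf) Hf] := HB k; have bk := @mbeta_gt0 R d k.
  rewrite [leRHS]mulrAC ler_wpM2r ?invr_ge0 ?(ltW bk) // -exprMn.
  rewrite lerXn2r ?Hf ?nnegrE ?normr_ge0 //.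
  exact: mulr_ge0 Bk f0.
- move=> f g /(Hol_closed_ball_DA d0) hf /(Hol_closed_ball_DA d0) hg.
  rewrite DA_inner_mul_zmonomial // /DAbar_inner conjfK /DA_inner.
  rewrite taylor_hankel_op; apply: isum_eq; apply: hsum_fin => k kJ.
  by rewrite hankel_coef_box // conjC0 mulr0 mul0r.
Qed.

(** Pairing with z^k isolates the k-th coefficient. Polynomials come first because the identity for
    [T] is given only on [Hol_closed_ball]. *)
Lemma is_hankel_mpoly m T a J k : (0 < d)%N -> is_hankel (zmonomial R m) T ->
  let P := fun z : Bd R d => mpoly a J (val z) in
  taylor (conjf (T P)) k = hankel_coef m P k.
Proof.
move=> d0 [_ _ _ _ HT] P; have hP : Hol_closed_ball P := mpoly_Hol a J.
have hk : Hol_closed_ball (zmonomial R k) by rewrite zmonomialE; apply: mpoly_Hol.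
have := HT P (zmonomial R k) hP hk.
rewrite /DAbar_inner conjfK DA_inner_mul_zmonomial; last 2 first.
- exact: Hol_closed_ball_DA.
- exact: Hol_closed_ball_DA.
have bk : mbeta k != 0 :> C by rewrite gt_eqF // mbeta_gt0.
have -> : DA_inner (zmonomial R k) (conjf (T P)) = (taylor (conjf (T P)) k)^* / mbeta k.
  rewrite /DA_inner -[X in X / _]mul1r.
  have -> : 1 = taylor (zmonomial R k) k :> C by rewrite taylor_zmonomial eqxx.
  apply: isum_eq; apply: (@hsum1 _ _ k) => n /negbTE nk.
  by rewrite taylor_zmonomial nk !mul0r.
have [kJ|kJ] := boolP (k \in box_fset m); last first.
  rewrite big_seq big1 => [/eqP|n nJ].
    by rewrite mulf_eq0 invr_eq0 (negbTE bk) orbF conjC_eq0 hankel_coef_box // => /eqP.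
  by rewrite taylor_zmonomial; case: eqP => [E|_]; [rewrite -E nJ in kJ|rewrite !mul0r].
rewrite (big_fsetD1 k) //= big_seq big1 ?addr0 => [|n]; last first.
  by rewrite !inE taylor_zmonomial => /andP[/negbTE-> _]; rewrite !mul0r.
rewrite taylor_zmonomial eqxx mul1r => /(mulIf (invr_neq0 bk)).
by move/(congr1 (fun x => x^*)); rewrite !conjCK.
Qed.

Lemma DA_approx f (e : C) : DA R d f -> 0 < e -> exists J,
  let r := fun z : Bd R d => f z - mpoly (taylor f) J (val z) in
  DA R d r /\ DA_norm r <= e.
Proof.
move=> hf e0; have e20 : 0 < e ^+ 2 by rewrite exprn_gt0.
have [J HJ] := hsum_tail (DA_norm_sqr hf) e20.
exists J => r; pose b n : C := if n \in J then 0 else taylor f n.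
have rb : has_power_series r b.
  have -> : r = fun z => -1 * mpoly (taylor f) J (val z) + f z.
    by apply/funext => z; rewrite mulN1r addrC.
  have -> : b = fun n => -1 * restrict (taylor f) J n + taylor f n.
    apply/funext => n; rewrite /b /restrict; case: ifP => _; last by rewrite mulr0 add0r.
    by rewrite mulN1r addNr.
  by apply: has_power_series_lin; [exact: mpoly_power_series|exact: DA_power_series].
have hr : DA R d r.
  exists b => //; apply: isummable_le (DA_isummable hf) => n.
  have bn : 0 <= (mbeta n)^-1 :> C by rewrite invr_ge0 ltW // mbeta_gt0.
  rewrite mulr_ge0 ?exprn_ge0 //= ler_wpM2r // /b; case: ifP => // _.
  by rewrite normr0 expr0n exprn_ge0.
split => //; rewrite -(ler_pXn2r (n := 2)) ?nnegrE ?(ltW e0) ?DA_norm_ge0 //.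
have := DA_norm_sqr hr; rewrite (taylor_eq rb) => h.
rewrite -[leLHS]ger0_norm ?exprn_ge0 ?DA_norm_ge0 //; apply: (hsum_norm_le h) => K.
have -> : \sum_(n <- K) `|b n| ^+ 2 / mbeta n =
    \sum_(n <- (K `\` J)%fset) `|taylor f n| ^+ 2 / mbeta n.
  rewrite -(big_fset_incl _ (fsubsetDl K J)) => [|n nK].
    by apply: eq_fbigr => n; rewrite !inE /b => /andP[/negbTE-> _].
  by rewrite !inE nK andbT negbK /b => ->; rewrite normr0 expr0n mul0r.
by apply/ltW/HJ/fdisjointP => n nJ; rewrite !inE nJ.
Qed.

(* The Hankel operator is determined on the dense subspace of polynomials. *)
Lemma is_hankel_taylor m T f : (0 < d)%N -> is_hankel (zmonomial R m) T -> DA R d f ->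
  taylor (conjf (T f)) = hankel_coef m f.
Proof.
move=> d0 hT hf; have [_ TDA Tlin [M HM] _] := hT.
apply/funext => k; apply/eqP; rewrite -subr_eq0 -normr_le0.
have [B B0 HB] := hankel_coef_le m k.
(* [A] bounds the contribution of the remainder r to both coefficients; the sign of [M] is unknown,
   so its absolute value enters. *)
pose A := sqrtC (mbeta k) * `|M| + B.
have A0 : 0 <= A by rewrite addr_ge0 ?mulr_ge0 ?sqrtC_ge0 // ltW // mbeta_gt0.
apply/ler_addgt0Pr => e e0; rewrite add0r.
have A1 : 0 < A + 1 by rewrite ltr_wpDl.
have [J [hr re]] := DA_approx hf (divr_gt0 e0 A1).
set r := fun z => _ in hr re; pose P := fun z : Bd R d => mpoly (taylor f) J (val z).
have hP : DA R d P by apply: mpoly_DA.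
have fE : f = fun z => 1 * P z + r z.
  by apply/funext => z; rewrite mul1r addrC subrK.
have r0 := DA_norm_ge0 hr.
have hTP := DAbar_DA (TDA _ hP); have hTr := DAbar_DA (TDA _ hr).
have E1 : taylor (conjf (T f)) k = hankel_coef m P k + taylor (conjf (T r)) k.
  rewrite -(is_hankel_mpoly (taylor f) J k d0 hT) -/P {1}fE Tlin //.
  rewrite (_ : conjf _ = fun z => 1 * conjf (T P) z + conjf (T r) z).
    by rewrite taylor_lin // mul1r.
  by apply/funext => z; rewrite /conjf !mul1r rmorphD.
have E2 : hankel_coef m f k = hankel_coef m P k + hankel_coef m r k.
  rewrite {1}/hankel_coef {1}fE taylor_lin // /hankel_coef; case: ifP => _; last by rewrite addr0.
  by rewrite mul1r rmorphD /= !mulrDl.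
rewrite E1 E2 opprD addrACA subrr add0r.
apply: le_trans (ler_normB _ _) _.
apply: (@le_trans _ _ (A * DA_norm r)); last first.
  apply: le_trans (ler_wpM2l A0 re) _; rewrite mulrCA -ler_pdivlMl // mulVf ?gt_eqF //.
  by rewrite ler_pdivrMr // mul1r lerDl.
rewrite mulrDl; apply: lerD; last exact: HB.
apply: le_trans (taylor_norm_le k hTr) _.
rewrite -mulrA ler_wpM2l ?sqrtC_ge0 ?(ltW (mbeta_gt0 _)) //.
have h := HM r hr; have T0 : 0 <= DA_norm (conjf (T r)) := DA_norm_ge0 hTr.
exact: ler_normMl T0 r0 h.
Qed.

Lemma hankel_ker_zmonomial m : (0 < d)%N ->
  hankel_ker (zmonomial R m) = [set f | DA R d f /\ forall n, mle n m -> taylor f n = 0].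
Proof.
(* Existence matters here: without a witness [hankel] would be the zero default, with all of [H_d]
   as its kernel. *)
move=> d0; have hT : is_hankel (zmonomial R m) (hankel (zmonomial R m)).
  apply: (@xgetPex _ _ [set T | is_hankel (zmonomial R m) T]).
  by exists (hankel_op m); exact: is_hankel_hankel_op.
have b0 k : mbeta k != 0 :> C by rewrite gt_eqF // mbeta_gt0.
have zero : @has_power_series R d (fun=> 0) (fun=> 0).
  move=> z; rewrite (_ : (fun n => _) = fun=> 0); first exact: hsum0.
  by apply/funext => n; rewrite mul0r.
apply/seteqP; split => f /= [hf].
  move=> Tf; split => // n nm.
  (* At k = m - n the coefficient is a nonzero multiple of the conjugate of f^(n). *)
  have := is_hankel_taylor d0 hT hf; rewrite Tf.
  have -> : conjf (fun=> 0) = (fun=> 0) :> (Bd R d -> C) by apply/funext => z; rewrite /conjf conjC0.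
  rewrite (taylor_eq zero) => /(congr1 (fun a => a (msub m n))).
  rewrite /hankel_coef mle_msub msubK // => /esym/eqP.
  by rewrite mulf_eq0 invr_eq0 (negbTE (b0 m)) orbF mulf_eq0 (negbTE (b0 _)) orbF conjC_eq0 => /eqP.
move=> f0; split => //; have h := is_hankel_taylor d0 hT hf.
have [_ TDA _ _ _] := hT; have hTf := DAbar_DA (TDA _ hf).
have E : conjf (hankel (zmonomial R m) f) = fun=> 0.
  apply/funext => z; have /hsum_unique := @DA_power_series _ _ _ hTf z; apply.
  rewrite (_ : (fun n => _) = fun=> 0); first exact: hsum0.
  apply/funext => k; rewrite h /hankel_coef; case: ifP => _; last by rewrite mul0r.
  by rewrite f0 ?mle_msub // conjC0 !mul0r.
by rewrite -[LHS]conjfK E; apply/funext => z; rewrite /conjf conjC0.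
Qed.

End Hankel.

(** * Monotone index sets and their enumeration *)

Section MonotoneSets.
Context {d : nat}.
Implicit Types (n k m : mindex d) (X : set (mindex d)).

(** By contraposition: if k lay outside X, adding unit vectors one at a time would stay outside X
    and reach n = k + (n - k). *)
Lemma monotone_down_closed X k n : monotone_index_set X -> mle k n -> X n -> X k.
Proof.
move=> hX /forallP kn Xn; apply: contrapT => nXk.
suff H : forall N (p : mindex d), mdegree p = N -> (~` X) ((k + p)%R : mindex d).
  apply: (H _ (msub n k) erefl); rewrite (_ : (k + msub n k)%R = n) //.
  by apply/ffunP => j; rewrite !ffunE; exact: subnKC.
elim=> [|N IH] p pN.
  rewrite (_ : (k + p)%R = k) //; apply/ffunP => j; rewrite !ffunE.
  move/eqP: pN; rewrite sum_nat_eq0 => /forallP/(_ j)/eqP ->; exact: addn0.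
have [j pj] : exists j, (0 < p j)%N.
  apply: contrapT => np; move: pN; rewrite /mdegree big1 // => j _.
  by apply/eqP; rewrite -leqn0 leqNgt; apply/negP => pj; apply: np; exists j.
pose q := msub p (unit_index j).
have qE : p = ((q + unit_index j)%R : mindex d).
  apply/ffunP => i; rewrite !ffunE; have [->|ij] := eqVneq i j.
    by apply/esym/subnK.
  by rewrite subn0; apply/esym/addn0.
rewrite qE addrA; apply: hX; apply: IH; apply: succn_inj; rewrite -pN qE.
rewrite /mdegree (bigD1 j) //= [in RHS](bigD1 j) //= -addSn; congr (_ + _)%N.
  by rewrite !ffunE eqxx; exact/esym/addn1.
by apply: eq_bigr => i /negbTE ij; rewrite [in RHS]ffunE [unit_index j i]ffunE ij; exact/esym/addn0.
Qed.

Lemma nonempty_index_set_enum X : X !=set0 -> exists m : nat -> mindex d,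
  forall n, X n <-> exists i, m i = n.
Proof.
move=> [x0 Xx0].
(* Numbers that encode no element of X are sent to the filler [x0], so the sequence stays in X. *)
exists (fun i : nat => if choice.unpickle i is Some n then (if `[<X n>] then n else x0) else x0) => n.
split=> [Xn|[k <-]]; last by case: choice.unpickle => // n'; case: ifP => // /asboolP.
by exists (choice.pickle n); rewrite choice.pickleK asboolT.
Qed.

Lemma bounded_enum X : bounded_index_set X ->
  exists s : seq (mindex d), forall n, X n <-> n \in s.
Proof.
move=> [N XN]; exists [seq n <- cube N.+1 | `[<X n>]] => n; rewrite mem_filter.
split=> [Xn|/andP[/asboolP]//]; rewrite asboolT //= in_cube; apply/forallP => j.
by rewrite ltnS (leq_trans _ (XN n Xn)) // /mdegree (bigD1 j) //= leq_addr.
Qed.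

End MonotoneSets.

Theorem mainTheorem3 (R : realType) (d : nat) (hd : (2 <= d)%N)
    (X : set (mindex d)) (hX : monotone_index_set X) :
  (bounded_index_set X ->
     exists (K : nat) (m : 'I_K -> mindex d),
       [/\ X = set0 -> K = 0%N,
           X = \bigcup_(k in [set: 'I_K]) box (m k)
         & DA_on R (~` X) =
             DA R d `&`
             \bigcap_(k in [set: 'I_K]) hankel_ker (zmonomial R (m k))])
  /\
  (~ bounded_index_set X ->
     exists m : nat -> mindex d,
       DA_on R (~` X) =
         \bigcap_(k in [set: nat]) hankel_ker (zmonomial R (m k))).
Proof.
have d0 : (0 < d)%N by apply: leq_trans hd.
split=> [/bounded_enum[s sX]|unb].
  (* All elements of X serve as corners: each n lies in its own box, and every box stays in X by
     downward closure. *)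
  exists (size s), (tnth (in_tuple s)); split.
  - by move=> X0; case: s sX => // n s /(_ n); rewrite X0 mem_head => -[_ /(_ isT)].
  - apply/seteqP; split=> [n /sX/seq_tnthP[i ->]|n [i _ /= ni]].
      by exists i => //= j; exact: leqnn.
    apply: (monotone_down_closed hX _ _); first exact/forallP/ni.
    by apply/sX; exact: mem_tnth.
  - apply/seteqP; split=> f /=.
      move=> [hf f0]; split=> // i _; rewrite hankel_ker_zmonomial //; split=> // n ni.
      apply: f0; rewrite setCK; apply: (monotone_down_closed hX ni).
      by apply/sX; exact: mem_tnth.
    move=> [hf fker]; split=> // n; rewrite setCK => /sX/seq_tnthP[i ->].
    have := fker i I; rewrite hankel_ker_zmonomial // => -[_]; apply.
    by apply/forallP.
have [m mX] : exists m : nat -> mindex d, forall n, X n <-> exists k, m k = n.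
  (* An empty X would be bounded, by 0. *)
  apply: nonempty_index_set_enum; apply: contrapT => X0; apply: unb.
  by exists 0%N => n Xn; case: X0; exists n.
exists m; apply/seteqP; split=> f /=.
  move=> [hf f0] k _; rewrite hankel_ker_zmonomial //; split=> // n nk.
  by apply: f0; rewrite setCK; apply: (monotone_down_closed hX nk); apply/mX; exists k.
move=> fker; split; first by have := fker 0%N I; rewrite hankel_ker_zmonomial // => -[].
move=> n; rewrite setCK => /mX[k <-].
have := fker k I; rewrite hankel_ker_zmonomial // => -[_]; apply.
by apply/forallP.
Qed.
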